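(* Let $p\neq 2$ be a prime, $d\ge 3$, and let $H$ be a $d$-generator special $p$-group of rank $\frac12 d(d-1)$. Then $|H\otimes H|\le p^{\frac13 d(d^2+3d-1)}$. Moreover, $\exp(H)=p$ if and only if $H\otimes H\cong\mathcal{M}(H)\oplus H'\oplus\nabla(H)\cong\mathbb{Z}_p^{(\frac13 d(d^2+3d-1))}$.
   Context: A special $p$-group is a finite non-abelian $p$-group $H$ with $H'=Z(H)=\Phi(H)$ elementary abelian; it has rank $k$ if $|H'|=p^k$. ''$d$-generator'' means that the minimal number of generators is $d$. $\exp$ denotes the exponent, $\mathbb{Z}_p^{(r)}$ the direct product of $r$ copies of the cyclic group of order $p$, and $\mathcal{M}(H)$ the Schur multiplier of $H$. The non-abelian tensor square $H\otimes H$ is the group generated by symbols $g\otimes h$ ($g,h\in H$) subject to $gg'\otimes h=({}^gg'\otimes{}^gh)(g\otimes h)$ and $g\otimes hh'=(g\otimes h)({}^hg\otimes{}^hh')$, where ${}^gx=gxg^{-1}$. $\nabla(H)=\langle g\otimes g\mid g\in H\rangle\le H\otimes H$. *)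

(* Defs.v *)
From HB Require Import structures.
From mathcomp Require Import all_boot all_order all_fingroup all_algebra all_solvable.
From mathcomp Require Import boolp classical_sets cardinality.

Set Implicit Arguments.
Unset Strict Implicit.
Unset Printing Implicit Defensive.

Import GRing.Theory.

Local Open Scope group_scope.

(* The letter (x, true) stands for the generator x, (x, false) for x^-1.      *)
Definition word (X : Type) := seq (X * bool).

Definition word_inv (X : Type) (w : word X) : word X :=
  rev [seq (a.1, ~~ a.2) | a <- w].

Inductive pres_eq (X : Type) (rels : word X -> word X -> Prop) :
    word X -> word X -> Prop :=
| pres_eq_rel u v : rels u v -> pres_eq rels u v
| pres_eq_cancel x b : pres_eq rels [:: (x, b); (x, ~~ b)] [::]
| pres_eq_cat u u' v v' :
    pres_eq rels u u' -> pres_eq rels v v' -> pres_eq rels (u ++ v) (u' ++ v')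
| pres_eq_refl u : pres_eq rels u u
| pres_eq_sym u v : pres_eq rels u v -> pres_eq rels v u
| pres_eq_trans u v w :
    pres_eq rels u v -> pres_eq rels v w -> pres_eq rels u w.

Section PresentedGroup.

Variables (X : choiceType) (rels : word X -> word X -> Prop).

Definition pres_eqb : rel (word X) := fun u v => `[< pres_eq rels u v >].

Lemma pres_eqb_refl : reflexive pres_eqb.
Proof. by move=> u; apply/asboolP; exact: pres_eq_refl. Qed.

Lemma pres_eqb_sym : symmetric pres_eqb.
Proof.
by move=> u v; apply/asboolP/asboolP => /pres_eq_sym.
Qed.

Lemma pres_eqb_trans : transitive pres_eqb.
Proof.
move=> v u w /asboolP uv /asboolP vw; apply/asboolP.
exact: pres_eq_trans uv vw.
Qed.

Canonical pres_equiv := EquivRel pres_eqb pres_eqb_refl pres_eqb_sym pres_eqb_trans.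

(* The quotient of the free group on X by the normal closure of the rels.     *)
Definition pres_group : Type := {eq_quot pres_equiv}%qT.

HB.instance Definition _ := Choice.copy pres_group {eq_quot pres_equiv}%qT.

Definition pres_class (w : word X) : pres_group := (\pi_{eq_quot pres_equiv} w)%qT.

Definition pres_repr (x : pres_group) : word X :=
  generic_quotient.repr (x : {eq_quot pres_equiv}%qT).

Definition pres_gen (x : X) : pres_group := pres_class [:: (x, true)].

Lemma pres_classP u v : pres_class u = pres_class v <-> pres_eq rels u v.
Proof.
split=> [/eqP|uv]; first by rewrite eqmodE => /asboolP.
by apply/eqP; rewrite eqmodE; apply/asboolP.
Qed.

Lemma pres_reprK x : pres_class (pres_repr x) = x.
Proof. exact: reprK. Qed.

Lemma pres_repr_class w : pres_eq rels (pres_repr (pres_class w)) w.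
Proof. by apply/pres_classP; rewrite pres_reprK. Qed.

Definition pres_one := pres_class [::].
Definition pres_mul x y := pres_class (pres_repr x ++ pres_repr y).
Definition pres_inv x := pres_class (word_inv (pres_repr x)).

Lemma pres_mulE u v :
  pres_mul (pres_class u) (pres_class v) = pres_class (u ++ v).
Proof. by apply/pres_classP; apply: pres_eq_cat; exact: pres_repr_class. Qed.

Lemma pres_mulA : associative pres_mul.
Proof.
move=> x y z; rewrite -[x]pres_reprK -[y]pres_reprK -[z]pres_reprK.
by rewrite !pres_mulE catA.
Qed.

Lemma pres_mul1 : left_id pres_one pres_mul.
Proof. by move=> x; rewrite -[x]pres_reprK pres_mulE. Qed.

Lemma pres_mulr1 : right_id pres_one pres_mul.
Proof. by move=> x; rewrite -[x]pres_reprK pres_mulE cats0. Qed.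

Lemma word_inv_cons (a : X * bool) (w : word X) :
  word_inv (a :: w) = word_inv w ++ [:: (a.1, ~~ a.2)].
Proof. by rewrite /word_inv /= rev_cons cats1. Qed.

Lemma word_invK : involutive (@word_inv X).
Proof.
move=> w; rewrite /word_inv map_rev revK -map_comp map_id_in // => -[x b] _ /=.
by rewrite negbK.
Qed.

Lemma pres_eq_mulV w : pres_eq rels (w ++ word_inv w) [::].
Proof.
elim: w => [|[x b] w IHw]; first exact: pres_eq_refl.
rewrite word_inv_cons /= -cat1s catA.
apply: pres_eq_trans (pres_eq_cancel _ x b).
rewrite -[X in pres_eq _ _ X]/([:: (x, b)] ++ ([::] ++ [:: (x, ~~ b)])) -catA.
apply: pres_eq_cat; first exact: pres_eq_refl.
by rewrite catA; apply: pres_eq_cat => //; exact: pres_eq_refl.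
Qed.

Lemma pres_mulrV : right_inverse pres_one pres_inv pres_mul.
Proof.
move=> x; rewrite -{1}[x]pres_reprK pres_mulE.
by apply/pres_classP; exact: pres_eq_mulV.
Qed.

Lemma pres_mulVr : left_inverse pres_one pres_inv pres_mul.
Proof.
move=> x; rewrite -{2}[x]pres_reprK pres_mulE; apply/pres_classP.
by rewrite -{2}[pres_repr x]word_invK; exact: pres_eq_mulV.
Qed.

HB.instance Definition _ := isGroup.Build pres_group
  pres_mulA pres_mul1 pres_mulr1 pres_mulVr pres_mulrV.

End PresentedGroup.

(* <<_>> is only available in finite groups, and finiteness of a presented    *)
(* group is a theorem.                                                        *)
Inductive in_gen (T : groupType) (S : T -> Prop) : T -> Prop :=
| in_gen_base x : S x -> in_gen S x
| in_gen1 : in_gen S 1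
| in_genM x y : in_gen S x -> in_gen S y -> in_gen S (x * y)
| in_genV x : in_gen S x -> in_gen S x^-1.

Definition gen_pred (T : groupType) (S : T -> Prop) : pred T :=
  fun x => `[< in_gen S x >].

Lemma gen_pred_closed (T : groupType) (S : T -> Prop) :
  group_closed (gen_pred S).
Proof.
split; first by apply/asboolP; exact: in_gen1.
move=> x y /asboolP Sx /asboolP Sy; apply/asboolP.
by apply: in_genM Sx _; exact: in_genV.
Qed.

Definition gen_group (T : groupType) (S : T -> Prop) : Type :=
  {x : T | gen_pred S x}.

HB.instance Definition _ (T : groupType) (S : T -> Prop) :=
  SubChoice.on (gen_group S).
HB.instance Definition _ (T : groupType) (S : T -> Prop) :=
  SubChoice_isSubGroup.Build T (gen_pred S) (gen_group S) (gen_pred_closed S).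

Section TensorSquare.

Variable G : groupType.

(* {}^g x = g x g^-1; beware that x ^ g is g^-1 x g in MathComp.              *)
Definition lconj (g x : G) : G := g * x * g^-1.

Inductive tensor_rels : word (G * G) -> word (G * G) -> Prop :=
| tensor_relMl g g' h :
    tensor_rels [:: ((g * g', h), true)]
                [:: ((lconj g g', lconj g h), true); ((g, h), true)]
| tensor_relMr g h h' :
    tensor_rels [:: ((g, h * h'), true)]
                [:: ((g, h), true); ((lconj h g, lconj h h'), true)].

Definition tensor_square := pres_group tensor_rels.

HB.instance Definition _ := Group.on tensor_square.

Definition tensor (g h : G) : tensor_square := pres_gen tensor_rels (g, h).

Definition nabla := gen_group (fun x : tensor_square => exists g, x = tensor g g).

HB.instance Definition _ := Group.on nabla.

End TensorSquare.

(* Schur multiplier of a finite group, as the integral homology group         *)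
(* H_2(G, Z) = ker d_2 / im d_3 of the inhomogeneous bar complex              *)

Section SchurMultiplier.

Local Open Scope ring_scope.

Variable G : finGroupType.

(* {ffun X -> int} is the free abelian group on X, with basis (basis x)_x.    *)
Definition basis (X : finType) (x : X) : {ffun X -> int} :=
  [ffun y => (y == x)%:Z].

Definition bar_d2 (c : {ffun G * G -> int}) : {ffun G -> int} :=
  \sum_(x : G * G) let: (g, h) := x in
    (basis h - basis (g * h)%g + basis g) *~ c x.

Definition bar_d3 (c : {ffun G * G * G -> int}) : {ffun G * G -> int} :=
  \sum_(x : G * G * G) let: (g, h, k) := x in
    (basis (h, k) - basis ((g * h)%g, k) + basis (g, (h * k)%g) - basis (g, h))
      *~ c x.

Lemma bar_d2_is_zmod_morphism : zmod_morphism bar_d2.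
Proof.
move=> a b; rewrite /bar_d2 -sumrB; apply: eq_bigr => -[g h] _.
by rewrite !ffunE mulrzBr.
Qed.

HB.instance Definition _ :=
  GRing.isZmodMorphism.Build _ _ bar_d2 bar_d2_is_zmod_morphism.

Lemma bar_d3_is_zmod_morphism : zmod_morphism bar_d3.
Proof.
move=> a b; rewrite /bar_d3 -sumrB; apply: eq_bigr => -[[g h] k] _.
by rewrite !ffunE mulrzBr.
Qed.

HB.instance Definition _ :=
  GRing.isZmodMorphism.Build _ _ bar_d3 bar_d3_is_zmod_morphism.

Definition cycle2 : {pred {ffun G * G -> int}} := fun c => bar_d2 c == 0.

Lemma cycle2_closed : zmod_closed cycle2.
Proof.
split=> [|a b /eqP da /eqP db]; apply/eqP; first by rewrite raddf0.
by rewrite bar_d2_is_zmod_morphism da db subrr.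
Qed.

HB.instance Definition _ :=
  GRing.isZmodClosed.Build {ffun G * G -> int} cycle2 cycle2_closed.

Definition Z2 : Type := {c : {ffun G * G -> int} | cycle2 c}.

HB.instance Definition _ := SubChoice.on Z2.
HB.instance Definition _ := [SubChoice_isSubZmodule of Z2 by <:].

Definition boundary2 : {pred Z2} :=
  fun z => `[< exists c, \val z = bar_d3 c >].

Lemma boundary2_closed : zmod_closed boundary2.
Proof.
split=> [|a b /asboolP [c ac] /asboolP [e be]]; apply/asboolP.
  by exists 0; rewrite !raddf0.
by exists (c - e); rewrite bar_d3_is_zmod_morphism -ac -be.
Qed.

HB.instance Definition _ :=
  GRing.isZmodClosed.Build Z2 boundary2 boundary2_closed.

Definition schur_multiplier : zmodType := Quotient.quot boundary2.

End SchurMultiplier.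

(* MathComp's [special] is H' = Z(H) = Phi(H) and allows abelian groups.      *)
Definition special_pgroup (gT : finGroupType) (p : nat) (H : {group gT}) : Prop :=
  [/\ p.-group H, ~~ abelian H, special H & p.-abelem H^`(1)].

Definition isomorphic (G K : groupType) : Prop :=
  exists f : {multiplicative G -> K}, bijective f.

Definition Zp_power (p r : nat) : groupType := Algebra.to_multiplicative 'rV['F_p]_r.

(* Main.v *)
Require Import Defs.
From HB Require Import structures.
From mathcomp Require Import all_boot all_order all_fingroup all_algebra all_solvable.
From mathcomp Require Import mxabelem.
From mathcomp Require Import boolp classical_sets cardinality.
From mathcomp Require Import zify ring.

(* As H has class 2, conjugation by commutators is trivial on H (x) H, which is
   therefore abelian. Written additively, the map l(z, h) = z (x) h on H' x H is
   bilinear, satisfies z (x) h = - h (x) z and the Jacobi identity, and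
     gh (x) k = g (x) k + h (x) k + l([g, h], k) - l([g, k], h).
   Hence the image L of l is a quotient of the degree 3 part of the free Lie
   algebra over F_p on d generators, of dimension (d^3 - d) / 3, and the quotient
   of H (x) H by L is spanned by the d^2 elements x_i (x) x_j and killed by p; this
   is the bound. Moreover l(g^p, g) = 0, so if x_i^p = prod [x_k, x_l]^a_kl is not
   1, it gives a nontrivial relation in L and the bound is strict.

   If exp(H) = p, then by counting H is the free class 2 group of exponent p, so it
   embeds in the units 1 + v + q of the tensor algebra truncated in degree 3. The
   functions v (x) v detect the x_i (x) x_j, and the degree 3 part of a product of
   such units is a 2-cocycle of H detecting L. Commutators of lifts in the
   universal central extension of H built on the bar complex map H (x) H to that
   extension, and the Schur multiplier is exactly the image of L. *)

Set Implicit Arguments.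
Unset Strict Implicit.
Unset Printing Implicit Defensive.

Import GRing.Theory.

Local Open Scope group_scope.

(** * Groups of class 2 *)

Definition class2 (G : groupType) := forall x y z : G, commute [~ x, y] z.

Lemma lconjE (G : groupType) : class2 G ->
  forall g x : G, lconj g x = x * [~ g, x].
Proof.
by move=> cl2 g x; rewrite /lconj (commgC g) -(mulgA x) -(cl2 g x g) mulgA mulgK.
Qed.

Lemma commMgl (G : groupType) : class2 G ->
  forall x y z : G, [~ x * y, z] = [~ x, z] * [~ y, z].
Proof.
move=> cl2 x y z; have e : [~ x * y, z] = [~ x, z] ^ y * [~ y, z].
  by rewrite !commgEl conjMg invMg !conjgE !mulgA !mulgK.
by rewrite e conjgE (cl2 x z y) mulKg.
Qed.

Lemma commMgr (G : groupType) : class2 G ->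
  forall x y z : G, [~ x, y * z] = [~ x, y] * [~ x, z].
Proof.
move=> cl2 x y z; rewrite -invgR commMgl // invMg !invgR.
exact/commute_sym/cl2.
Qed.

(** In a finite group the elements of [<<A>>] are plain products of elements of [A], so no case for
    inverses arises. *)
Lemma gen_ind (gT : finGroupType) (A : {set gT}) (P : gT -> Prop) :
  P 1 -> (forall a y, a \in A -> y \in <<A>> -> P y -> P (a * y)) ->
  forall x, x \in <<A>> -> P x.
Proof.
move=> P1 PM x /gen_prodgP[n [c Ac ->]].
elim: n c Ac => [|n IHn] c Ac; first by rewrite big_ord0.
rewrite big_ord_recl; apply: PM => //; last exact: IHn.
by apply: group_prod => i _; apply: mem_gen.
Qed.

Section GroupAdditive.

Variables (G : groupType) (A : zmodType) (f : G -> A).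
Hypothesis fM : forall x y, f (x * y) = (f x + f y)%R.

Lemma gadd1 : f 1 = 0%R.
Proof. by apply: (addIr (f 1)); rewrite -fM mulg1 add0r. Qed.

Lemma gaddV x : f x^-1 = (- f x)%R.
Proof. by apply: (addIr (f x)); rewrite -fM mulVg gadd1 addNr. Qed.

Lemma gaddR x y : f [~ x, y] = 0%R.
Proof. by rewrite !fM !gaddV (addrCA (- f y)%R) addKr addNr. Qed.

Lemma gaddX x n : f (x ^+ n) = (f x *+ n)%R.
Proof.
by elim: n => [|n IHn]; rewrite ?mulr0n ?gadd1 // expgS fM IHn mulrS.
Qed.

End GroupAdditive.

(** * Crossed pairings into abelian groups *)

(** The defining relations of the tensor square in additive notation. The computations below thus
    take place in an abelian group rather than with words. *)
Definition crossed_pairing (G : groupType) (A : zmodType) (t : G -> G -> A) :=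
  (forall g g' h, t (g * g') h = (t (lconj g g') (lconj g h) + t g h)%R) /\
  (forall g h h', t g (h * h') = (t g h + t (lconj h g) (lconj h h'))%R).

Section CrossedPairing.

Local Open Scope ring_scope.

Variables (G : finGroupType) (A : zmodType) (t : G -> G -> A).
Hypothesis cl2 : class2 G.
Hypothesis tP : crossed_pairing t.

Let tMl0 := tP.1.
Let tMr0 := tP.2.

Implicit Types g h k z : G.

Definition central z := forall h, commute z h.

Lemma centralR g h : central [~ g, h]. Proof. by move=> k; apply: cl2. Qed.

Lemma lconjz z h : central z -> lconj z h = h.
Proof. by move=> cz; rewrite /lconj cz mulgK. Qed.

Lemma lconjgz z h : central z -> lconj h z = z.
Proof. by move=> cz; rewrite /lconj -cz mulgK. Qed.

Lemma tzMl z g h : central z -> t (z * g)%g h = t z h + t g h.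
Proof. by move=> cz; rewrite tMl0 !lconjz // addrC. Qed.

Lemma tzMr g z h : central z -> t g (z * h)%g = t g z + t g h.
Proof. by move=> cz; rewrite tMr0 !lconjz. Qed.

(** Expand [t (z * g) h = t (g * z) h] in both orders. *)
Lemma tz_lconj z g h : central z -> t z (lconj g h) = t z h.
Proof.
move=> cz; apply: (addIr (t g h)).
by rewrite -tzMl // (cz g) tMl0 (lconjgz _ cz).
Qed.

Lemma tz_additive z : central z -> forall h k, t z (h * k)%g = t z h + t z k.
Proof. by move=> cz h k; rewrite tMr0 (lconjgz h cz) tz_lconj. Qed.

Lemma t0z z g h : central z -> t z [~ g, h] = 0.
Proof. by move=> cz; exact: (gaddR (tz_additive cz)). Qed.

Lemma tMl g h k :
  t (g * h)%g k = t g k + t h k + t [~ g, h] k + t h [~ g, k].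
Proof.
have [c1 c2] := (centralR g h, centralR g k).
rewrite tMl0 !lconjE // -(c1 h) (tzMl _ _ c1) -(c2 k) !(tzMr _ _ c2) (t0z _ _ c1).
by rewrite add0r (AC (1*2*1) (4*3*1*2)).
Qed.

Lemma tMr g h k :
  t g (h * k)%g = t g h + t g k + t g [~ h, k] + t [~ h, g] k.
Proof.
have [c1 c2] := (centralR h g, centralR h k).
rewrite tMr0 !lconjE // -(c1 g) (tzMl _ _ c1) -(c2 k) !(tzMr _ _ c2) (t0z _ _ c1).
by rewrite add0r (AC (1*(1*2)) (1*4*3*2)).
Qed.

Lemma tz1l k : t 1%g k = 0.
Proof.
apply: (addIr (t 1%g k)); rewrite -tzMl ?mulg1 ?add0r //.
by move=> h; apply/commute_sym/commute1.
Qed.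

Lemma tzVl z k : central z -> t z^-1%g k = - t z k.
Proof.
by move=> cz; apply: (addrI (t z k)); rewrite -tzMl // mulgV tz1l subrr.
Qed.

Lemma tzXl z k n : central z -> t (z ^+ n)%g k = t z k *+ n.
Proof.
by move=> cz; elim: n => [|n IHn]; rewrite ?tz1l // expgS tzMl // IHn mulrS.
Qed.

Lemma tRVl g h k : t [~ g, h] k = - t [~ h, g] k.
Proof. by rewrite -tzVl ?invgR //; apply: centralR. Qed.

Lemma tRVr g h k : t k [~ g, h] = - t k [~ h, g].
Proof.
have c := centralR h g; rewrite -invgR; apply: (addrI (t k [~ h, g])).
rewrite -(tzMr _ _ c) mulgV subrr; apply: (addIr (t k 1%g)).
by rewrite -tzMr ?mulg1 ?add0r // => x; apply/commute_sym/commute1.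
Qed.

(* From the two expansions of [t (g * h) k] given by [g * h = h * g * [~ g, h]]. *)
Lemma tRl g h k : t [~ g, h] k + t h [~ g, k] = t g [~ h, k].
Proof.
have c := centralR g h; have := tMl g h k.
rewrite {1}(commgC g h) -(c (h * g)%g) (tzMl _ _ c) tMl (tRVl h g) => e.
apply: (addrI (t g k + t h k)); rewrite addrA -e.
by rewrite [LHS](AC (1*4) ((1*4)*(3*2)*5)) /= subrr add0r.
Qed.

(** The mirror image of [tRl], from the two expansions of [t g (h * k)]. *)
Lemma tRr g h k : t g [~ h, k] = t [~ k, g] h - t [~ h, g] k.
Proof.
have c := centralR h k; have := tMr g h k.
rewrite {1}(commgC h k) -(c (k * h)%g) (tzMr _ _ c) tMr (tRVr k h) => e.
apply: (addIr (t [~ h, g] k)); rewrite addrNK.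
apply: (addrI (t g h + t g k)); rewrite addrA -e.
by rewrite [LHS](AC (1*4) ((1*4)*(3*2)*5)) /= subrr add0r.
Qed.

(** [tRl] and [tRr] give two values of [t g [~ h, k]]; the common term [t [~ g, h] k] cancels. *)
Lemma t_antiR g h k : t h [~ g, k] = - t [~ g, k] h.
Proof.
by have := tRl g h k; rewrite (tRr g h k) (tRVl h g) opprK addrC -tRVl => /addIr.
Qed.

Lemma t_mull g h k :
  t (g * h)%g k = t g k + t h k + t [~ g, h] k - t [~ g, k] h.
Proof. by rewrite tMl t_antiR. Qed.

Lemma t_mulr g h k :
  t g (h * k)%g = t g h + t g k + t [~ h, g] k - t [~ h, k] g.
Proof. by rewrite tMr t_antiR addrAC. Qed.

(** This is [tRl] once [t_antiR] has moved all commutators to the left argument. *)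
Lemma t_jacobi g h k : t [~ g, h] k + t [~ h, k] g + t [~ k, g] h = 0.
Proof.
by rewrite (tRVl k g) -t_antiR addrAC tRl t_antiR addNr.
Qed.

Lemma central_der1 z : z \in [set: G]^`(1)%g -> central z.
Proof.
rewrite derg1; move: z; apply: gen_ind => [h | a y /imset2P[g h _ _ ->] _ cy k].
  exact/commute_sym/commute1.
exact/commute_sym/commuteM/commute_sym/cy/commute_sym/centralR.
Qed.

Lemma t_anti z h : z \in [set: G]^`(1)%g -> t h z = - t z h.
Proof.
rewrite derg1; move: z; apply: gen_ind => [| _ y /imset2P[g k _ _ ->] _ IHy].
  by rewrite -(commgg 1%g) t_antiR.
have c := centralR g k.
by rewrite (tzMr _ _ c) (tzMl _ _ c) t_antiR IHy opprD.
Qed.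

(** By [t_mull], passing from [n] to [n.+1] adds [t g k] and the correction [- t [~ g, k] (g ^+ n)],
    which is [n] times [- t [~ g, k] g]. *)
Lemma t_expl g k n :
  t (g ^+ n)%g k = t g k *+ n - t [~ g, k] g *+ 'C(n, 2).
Proof.
elim: n => [|n IHn]; first by rewrite tz1l bin0n subr0.
rewrite expgS t_mull commgXg tz1l addr0 IHn mulrS binS bin1 mulrnDr.
rewrite (gaddX (tz_additive _)); last exact: centralR.
by rewrite opprD !addrA.
Qed.

Lemma t_exp_odd p g k : odd p -> (g ^+ p)%g \in [set: G]^`(1)%g ->
  (forall z, z \in [set: G]^`(1)%g -> (z ^+ p)%g = 1%g) ->
  t g k *+ p = t (g ^+ p)%g k.
Proof.
move=> p_odd gp zp; rewrite t_expl bin2odd // mulrnA.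
rewrite -(tzXl _ _ (centralR _ _)) zp ?tz1l ?mul0rn ?subr0 //.
by rewrite derg1 mem_commg ?inE.
Qed.

(** Both [t (g ^+ p) g] and [t g (g ^+ p)] equal [p] times [t g g], while [t_anti] makes them
    opposite. The value is thus killed by 2 and by the odd number [p]. *)
Lemma t_exp_self p g : odd p -> (g ^+ p)%g \in [set: G]^`(1)%g ->
  (g ^+ p ^+ p)%g = 1%g -> t (g ^+ p)%g g = 0.
Proof.
move=> p_odd gp gpp; have cgp := central_der1 gp.
have tgX n : t g (g ^+ n)%g = t g g *+ n.
  elim: n => [|n IHn]; first by rewrite mulr0n expg0 -(commgg 1%g) t_antiR commgg tz1l oppr0.
  by rewrite expgS t_mulr commgXg commgg !tz1l addr0 subr0 IHn mulrS.
have: t (g ^+ p)%g g *+ 2 = 0.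
  by rewrite mulr2n {1}t_expl commgg tz1l mul0rn subr0 -tgX t_anti // addNr.
have: t (g ^+ p)%g g *+ p = 0 by rewrite -tzXl // gpp tz1l.
rewrite -(odd_double_half p) p_odd mulrnDr mulr1n -muln2 mulnC mulrnA.
by move=> + e2; rewrite e2 mul0rn addr0.
Qed.

(** The commutator corrections cancel on the diagonal: [t g g] behaves as a quadratic form with
    polar form [t g h + t h g], which is biadditive by [t_symMl]. This governs nabla. *)
Lemma t_sqr g h :
  t (g * h)%g (g * h)%g = t g g + t h h + (t g h + t h g).
Proof.
have c := centralR g h.
have e : [~ g, (g * h)%g]%g = [~ g, h]%g by rewrite commMgr // commgg mul1g.
rewrite t_mull (t_mulr g g h) (t_mulr h g h) (tz_additive c) e commgg tz1l.
rewrite addr0 addrK [t _ g + t _ h]addrC addrA addrK.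
rewrite (AC (3*2*1) ((1*5)*(2*4)*(3*6))) /= addNr addr0.
by rewrite [LHS](AC (2*2) ((3*2)*(1*4))).
Qed.

Lemma t_symMl g g' h :
  t (g * g')%g h + t h (g * g')%g = (t g h + t h g) + (t g' h + t h g').
Proof.
rewrite t_mull t_mulr.
rewrite (AC (4*4) ((1*5)*(2*6)*(3*8)*(4*7))) /= addrN addNr !addr0.
by [].
Qed.

End CrossedPairing.

(** * Integer spans of finite families in an abelian group *)

Section Span.

Local Open Scope ring_scope.

Variables (A : zmodType) (I : finType) (e : I -> A).

Definition span (x : A) : Prop := exists a : I -> int, x = \sum_i e i *~ a i.

Lemma span0 : span 0.
Proof. by exists (fun=> 0); rewrite big1. Qed.

Lemma spanD x y : span x -> span y -> span (x + y).
Proof.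
move=> [a ->] [b ->]; exists (fun i => a i + b i).
by rewrite -big_split; apply: eq_bigr => i _; rewrite mulrzDr.
Qed.

Lemma spanN x : span x -> span (- x).
Proof.
move=> [a ->]; exists (fun i => - a i).
by rewrite -sumrN; apply: eq_bigr => i _; rewrite mulrNz.
Qed.

Lemma spanB x y : span x -> span y -> span (x - y).
Proof. by move=> sx sy; apply/spanD/spanN. Qed.

Lemma span_mem i : span (e i).
Proof.
exists (fun j => (j == i)%:Z); rewrite (bigD1 i) //= eqxx big1 ?addr0 // => j.
by move/negPf ->.
Qed.

Lemma spanMz x n : span x -> span (x *~ n).
Proof.
move=> [a ->]; exists (fun i => a i * n).
by rewrite mulrz_suml; apply: eq_bigr => i _; rewrite mulrzA.
Qed.

Lemma spanMn x n : span x -> span (x *+ n).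
Proof. exact: (@spanMz x n). Qed.

Lemma span_ind (P : A -> Prop) : P 0 -> (forall x y, P x -> P y -> P (x + y)) ->
  (forall x, P x -> P (- x)) -> (forall i, P (e i)) -> forall x, span x -> P x.
Proof.
move=> P0 PD PN Pe x [a ->]; apply: (big_ind P) => // i _.
have PMn n : P (e i *+ n).
  by elim: n => [|n IHn]; rewrite ?mulr0n // mulrS; apply: PD.
by case: (a i) => n; [exact: PMn | exact/PN/PMn].
Qed.

Lemma span_sum (K : finType) (P : pred K) (F : K -> A) :
  (forall k, P k -> span (F k)) -> span (\sum_(k | P k) F k).
Proof. by move=> sF; apply: big_ind => //; [exact: span0 | exact: spanD]. Qed.

Lemma span_modp p x : (forall i, e i *+ p = 0) -> (0 < p)%N -> span x ->
  exists u : {ffun I -> 'I_p}, x = \sum_i e i *+ u i.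
Proof.
move=> pe p_gt0 [a ->].
have lt_p i : (`|(a i %% p)%Z| < p)%N.
  by have := modz_ge0 (a i) (d := p); have := ltz_pmod (a i) (d := p); lia.
exists [ffun i => Ordinal (lt_p i)]; apply: eq_bigr => i _; rewrite ffunE /=.
rewrite {1}(divz_eq (a i) p) mulrzDr mulrC mulrzA -pmulrn pe mul0rz add0r.
by rewrite pmulrn; congr (_ *~ _); have := modz_ge0 (a i) (d := p); lia.
Qed.

End Span.

Lemma span_sub (A : zmodType) (I J : finType) (e : I -> A) (f : J -> A) :
  (forall i, span f (e i)) -> forall x, span e x -> span f x.
Proof. by move=> ef x [a ->]; apply: span_sum => i _; apply: spanMz. Qed.

(* (i, j, k) stands for the Lie monomial [[x_i, x_j], x_k]; the constraint selects
   a Hall basis of the degree 3 part of the free Lie algebra. *)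
Definition lie_index d :=
  {x : 'I_d * 'I_d * 'I_d | (x.1.1 < x.1.2) && (x.1.1 <= x.2)}.

Definition sym_index d := {x : 'I_d * 'I_d | x.1 <= x.2}.

(** * Spanning families for the values of a crossed pairing *)

Section CrossedPairingSpan.

Local Open Scope ring_scope.

Variables (G : finGroupType) (A : zmodType) (t : G -> G -> A).
Hypothesis cl2 : class2 G.
Hypothesis tP : crossed_pairing t.

Variables (d : nat) (x : 'I_d -> G).
Hypothesis x_gen : <<[set x i | i : 'I_d]>>%g = [set: G].

Definition lam i j k := t [~ x i, x j] (x k).
Definition lamJ (j : lie_index d) := lam (val j).1.1 (val j).1.2 (val j).2.
Definition ten (ij : 'I_d * 'I_d) := t (x ij.1) (x ij.2).
Definition tenJ (ij : ('I_d * 'I_d) + lie_index d) :=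
  match ij with inl ij => ten ij | inr j => lamJ j end.
Definition symJ (ij : sym_index d) : A :=
  let: (i, j) := val ij in
  if i == j then t (x i) (x i) else t (x i) (x j) + t (x j) (x i).

Let addz z (cz : central z) := tz_additive tP cz.

(** The Jacobi identity in the form that brings the third index to the front, as needed when it is
    the smallest. *)
Lemma lam_jacobi i j k : lam i j k = lam k j i - lam k i j.
Proof.
have := t_jacobi cl2 tP (x i) (x j) (x k).
rewrite (tRVl cl2 tP (x j) (x k)) addrAC => /eqP.
by rewrite subr_eq0 -/(lam _ _ _) => /eqP; rewrite /lam => <-; rewrite addrK.
Qed.

Lemma lam_basis i j k : span lamJ (lam i j k).
Proof.
have basis (a b c : 'I_d) (ab : (a < b)%N) (ac : (a <= c)%N) : span lamJ (lam a b c).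
  have abc : (a < b)%N && (a <= c)%N by rewrite ab.
  exact: (span_mem lamJ (exist _ (a, b, c) abc)).
have lt (a b c : 'I_d) : (a < b)%N -> span lamJ (lam a b c).
  move=> ab; case: (leqP a c) => [|ca]; first exact: basis.
  by rewrite lam_jacobi; apply: spanB; apply: basis => //; lia.
case: (ltngtP i j) => [||/val_inj ->]; first exact: lt.
  by move=> ji; rewrite /lam (tRVl cl2 tP); apply/spanN/lt.
by rewrite /lam commgg (tz1l tP); apply: span0.
Qed.

Lemma gen_x (P : G -> Prop) :
  P 1%g -> (forall i y, P y -> P (x i * y)%g) -> forall g, P g.
Proof.
move=> P1 PM g; have: g \in <<[set x i | i : 'I_d]>>%g by rewrite x_gen inE.
move: g; apply: gen_ind => // _ y /imsetP[i _ ->] _; exact: PM.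
Qed.

Lemma span_lam g h k : span lamJ (t [~ g, h]%g k).
Proof.
have c := centralR cl2.
move: g; apply: gen_x => [|i g IH]; first by rewrite comm1g (tz1l tP); exact: span0.
rewrite (commMgl cl2) (tzMl tP _ _ (c _ _)); apply: spanD IH.
move: h; apply: gen_x => [|j h IH]; first by rewrite commg1 (tz1l tP); exact: span0.
rewrite (commMgr cl2) (tzMl tP _ _ (c _ _)); apply: spanD IH.
move: k; apply: gen_x => [|k h' IH]; first by rewrite (gadd1 (addz (c _ _))); exact: span0.
by rewrite (addz (c _ _)); apply: spanD IH; exact: lam_basis.
Qed.

Lemma span_lam_der1 z k : z \in [set: G]^`(1)%g -> span lamJ (t z k).
Proof.
rewrite derg1; move: z; apply: gen_ind => [|_ y /imset2P[g h _ _ ->] _ IH].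
  by rewrite (tz1l tP); exact: span0.
rewrite (tzMl tP _ _ (centralR cl2 _ _)); apply: spanD IH; exact: span_lam.
Qed.

(** Induction on both arguments: [t_mull] and [t_mulr] are additive up to values of [t] on
    commutators, which [span_lam] covers. *)
Lemma span_ten g h : span tenJ (t g h).
Proof.
have lamW y : span lamJ y -> span tenJ y.
  by apply: span_sub => j; exact: (span_mem tenJ (inr j)).
move: g; apply: gen_x => [|i g IHg]; first by rewrite (tz1l tP); exact: span0.
rewrite (t_mull cl2 tP); apply/spanB/lamW/span_lam.
apply/spanD/lamW/span_lam; apply: spanD IHg.
move: h; apply: gen_x => [|j h IHh].
  rewrite -(commgg 1%g) (t_antiR cl2 tP); apply/spanN/lamW/span_lam.
rewrite (t_mulr cl2 tP); apply/spanB/lamW/span_lam.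
apply/spanD/lamW/span_lam; apply: spanD IHh; exact: (span_mem tenJ (inl (i, j))).
Qed.

Lemma span_sym g : span symJ (t g g).
Proof.
have BC g' h : t g' h + t h g' = t h g' + t g' h by rewrite addrC.
have BM := t_symMl cl2 tP.
have t11 : t 1%g 1%g = 0 by rewrite (tz1l tP).
have basisB i j : span symJ (t (x i) (x j) + t (x j) (x i)).
  wlog le_ij : i j / (i <= j)%N => [hw|].
    by case: (leqP i j) => [|/ltnW] /hw //; rewrite addrC.
  have := span_mem symJ (exist _ (i, j) le_ij); rewrite /symJ /=.
  (* On the diagonal the polar form is twice the member of [symJ]. *)
  by case: eqP => [-> /(spanMn 2)|//]; rewrite mulr2n.
have B1 h : span symJ (t 1%g h + t h 1%g).
  suff -> : t 1%g h + t h 1%g = 0 by exact: span0.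
  by apply: (addIr (t 1%g h + t h 1%g)); rewrite -BM mulg1 add0r.
have Bsp g' h : span symJ (t g' h + t h g').
  move: g'; apply: gen_x => [//|i g' IH]; rewrite BM; apply: spanD IH.
  rewrite BC; move: h; apply: gen_x => [//|j h IH]; rewrite BM; apply: spanD IH.
  exact: basisB.
move: g; apply: gen_x => [|i g IH]; first by rewrite t11; exact: span0.
rewrite (t_sqr cl2 tP); apply: spanD (Bsp _ _); apply: spanD IH.
have := span_mem symJ (exist _ (i, i) (leqnn i)); by rewrite /symJ /= eqxx.
Qed.

End CrossedPairingSpan.

(** * Normal forms in the derived subgroup *)

Section CommutatorProducts.

Variables (G : finGroupType) (d : nat) (x : 'I_d -> G).
Hypothesis cl2 : class2 G.
Hypothesis x_gen : <<[set x i | i : 'I_d]>> = [set: G].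

Definition cprod (a : 'I_d * 'I_d -> nat) : G :=
  \prod_(ij : 'I_d * 'I_d | ij.1 < ij.2) [~ x ij.1, x ij.2] ^+ a ij.

Lemma cprodD a b : cprod (fun ij => a ij + b ij)%N = cprod a * cprod b.
Proof.
rewrite /cprod -prodgM_commute => [|i j _ _]; last first.
  by apply: commuteX2; apply: cl2.
by apply: eq_bigr => ij _; rewrite expgnDr.
Qed.

Lemma cprod_eq1 p a : (forall z, z \in [set: G]^`(1) -> z ^+ p = 1) ->
  (forall ij : 'I_d * 'I_d, ij.1 < ij.2 -> p %| a ij) -> cprod a = 1.
Proof.
move=> zp pa; apply: big1 => ij /pa/dvdnP[k ->].
by rewrite mulnC expgnA zp ?expg1n // derg1 mem_commg ?inE.
Qed.

Lemma der1_cprod p z : 0 < p -> (forall z, z \in [set: G]^`(1) -> z ^+ p = 1) ->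
  z \in [set: G]^`(1) -> exists a, z = cprod a.
Proof.
move=> p_gt0 zp.
have c1 : exists a, 1 = cprod a.
  by exists (fun=> 0%N); rewrite /cprod big1.
have cM y y' : (exists a, y = cprod a) -> (exists a, y' = cprod a) ->
    exists a, y * y' = cprod a.
  by move=> [a ->] [b ->]; exists (fun ij => a ij + b ij)%N; rewrite cprodD.
have cX y n : (exists a, y = cprod a) -> exists a, y ^+ n = cprod a.
  by move=> cy; elim: n => [//|n IHn]; rewrite expgS; apply: cM.
have clt (i j : 'I_d) : i < j -> exists a, [~ x i, x j] = cprod a.
  move=> ij; exists (fun k => (k == (i, j) : nat)).
  rewrite /cprod (eq_bigr (fun k => if k == (i, j) then [~ x k.1, x k.2] else 1)).
    rewrite -big_mkcondr (big_pred1 (i, j)) // => k /=.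
    by rewrite andb_idl // => /eqP->.
  by move=> k _; case: eqP.
have cx i j : exists a, [~ x i, x j] = cprod a.
  case: (ltngtP i j) => [||/val_inj ->]; first exact: clt.
    move=> ji; rewrite -invgR; have xp : [~ x j, x i] ^+ p = 1.
      by rewrite zp // derg1 mem_commg ?inE.
    (* Exponents are natural numbers, so the inverse is written as the power of exponent [p.-1]. *)
    rewrite -[_^-1]mul1g -xp -(prednK p_gt0) expgSr mulgK; exact/cX/clt.
  by rewrite commgg.
rewrite derg1; move: z; apply: gen_ind => // _ y /imset2P[g h _ _ ->] _.
apply: (cM _ _).
move: g; apply: (gen_x x_gen) => [|i g IH]; first by rewrite comm1g.
rewrite commMgl //; apply: (cM _ _) IH.
move: h; apply: (gen_x x_gen) => [|j h IH]; first by rewrite commg1.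
by rewrite commMgr //; apply: (cM _ _) IH.
Qed.

End CommutatorProducts.

(** * The counting bound, and the relation caused by a nontrivial [p]-th power *)

Section CrossedPairingBound.

Local Open Scope ring_scope.

Variables (G : finGroupType) (A : zmodType) (t : G -> G -> A).
Hypothesis cl2 : class2 G.
Hypothesis tP : crossed_pairing t.

Variables (d : nat) (x : 'I_d -> G).
Hypothesis x_gen : <<[set x i | i : 'I_d]>>%g = [set: G].

Variable p : nat.
Hypothesis p_pr : prime p.
Hypothesis p_odd : odd p.
Hypothesis GpD : forall g, (g ^+ p)%g \in [set: G]^`(1)%g.
Hypothesis Dp1 : forall z, z \in [set: G]^`(1)%g -> (z ^+ p)%g = 1%g.

Lemma lam_p i j k : lam t x i j k *+ p = 0.
Proof. by rewrite -(tzXl tP) ?Dp1 ?(tz1l tP) // derg1 mem_commg ?inE. Qed.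

Lemma lamJ_p j : lamJ t x j *+ p = 0.
Proof. exact: lam_p. Qed.

Lemma span_ten_p ij : span (lamJ t x) (ten t x ij *+ p).
Proof.
rewrite /ten (t_exp_odd cl2 tP) //; exact: (span_lam_der1 cl2 tP).
Qed.

Lemma tz_cprod a k : t (cprod x a) k =
  \sum_(ij : 'I_d * 'I_d | (ij.1 < ij.2)%N) t [~ x ij.1, x ij.2]%g k *+ a ij.
Proof.
suff [] : central (cprod x a) /\ t (cprod x a) k =
  \sum_(ij : 'I_d * 'I_d | (ij.1 < ij.2)%N) t [~ x ij.1, x ij.2]%g k *+ a ij by [].
rewrite /cprod; elim/big_rec2: _ => [|ij s z _ [cz <-]].
  by split; [move=> h; apply/commute_sym/commute1 | exact: tz1l].
have cR := centralR cl2 (x ij.1) (x ij.2).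
have cX : central ([~ x ij.1, x ij.2] ^+ a ij).
  by move=> h; apply/commute_sym/commuteX/commute_sym/cR.
split; first by move=> h; apply/commute_sym/commuteM/commute_sym/cz/commute_sym/cX.
by rewrite (tzMl tP _ _ cX) (tzXl tP _ _ cR).
Qed.

(** The family [e] is left open: all of [lamJ] gives the general bound, and [lamJ] without one
    member gives the strict bound. *)
Lemma pairing_coords (J : finType) (e : J -> A) a :
  (forall j, span e (lamJ t x j)) -> (forall j, e j *+ p = 0) ->
  span (tenJ t x) a ->
  exists u : {ffun 'I_d * 'I_d -> 'I_p}, exists v : {ffun J -> 'I_p},
    a = \sum_ij ten t x ij *+ u ij + \sum_j e j *+ v j.
Proof.
move=> le ep [b ->]; have p_gt0 := prime_gt0 p_pr.
have lt_p ij : (`|(b (inl ij) %% p)%Z| < p)%N.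
  by have := @modz_ge0 (b (inl ij)) p; have := @ltz_pmod (b (inl ij)) p; lia.
pose u : {ffun 'I_d * 'I_d -> 'I_p} := [ffun ij => Ordinal (lt_p ij)]; exists u.
suff /(span_modp ep p_gt0)[v ev] :
    (* After reduction of the coefficients of [ten] modulo [p], the remaining multiples of [p] lie
       in the span of [lamJ] by [span_ten_p], hence in that of [e]. *)
    span e (\sum_i tenJ t x i *~ b i - \sum_ij ten t x ij *+ u ij).
  by exists v; rewrite -ev addrC subrK.
rewrite big_sumType /= addrAC -sumrB; apply: spanD; last first.
  by apply: span_sum => j _; exact/spanMz/le.
apply: span_sum => ij _.
have -> : b (inl ij) = (b (inl ij) %/ p)%Z * p + (u ij)%:Z.
  rewrite {1}(divz_eq (b (inl ij)) p); congr (_ + _); rewrite ffunE /=.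
  by have := @modz_ge0 (b (inl ij)) p; lia.
rewrite mulrzDr -pmulrn addrK mulrC mulrzA -pmulrn; apply: spanMz.
by apply: (span_sub le); exact: span_ten_p.
Qed.

(* The relation is [t (x i0 ^+ p) (x i0) = 0], expanded along [der1_cprod]. *)
Lemma lam_relation (i0 : 'I_d) : val i0 = 0%N -> (x i0 ^+ p)%g <> 1%g ->
  exists j0 : lie_index d, forall j,
    span (fun j : {j | j != j0} => lamJ t x (val j)) (lamJ t x j).
Proof.
move=> i00 xp1; have p_gt0 := prime_gt0 p_pr.
have [a xpa] := der1_cprod cl2 x_gen p_gt0 Dp1 (GpD (x i0)).
have [/existsP[[k l]] | /existsPn all_dvd] :=
    boolP [exists ij : 'I_d * 'I_d, (ij.1 < ij.2)%N && ~~ (p %| a ij)%N]; last first.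
  case: xp1; rewrite xpa; apply: (cprod_eq1 _ Dp1) => ij lt_ij.
  by have := all_dvd ij; rewrite lt_ij /= negbK.
move=> /= /andP[lt_kl pa].
have idxP (i j : 'I_d) : (0 < i)%N -> (i0 < i)%N && (i0 <= j)%N.
  by move=> i_gt0; rewrite i00 i_gt0.
pose idx i j (i_gt0 : (0 < val i)%N) : lie_index d := exist _ (i0, i, j) (idxP i j i_gt0).
have l_gt0 : (0 < l)%N by apply: leq_ltn_trans lt_kl.
(* The monomial to eliminate is [[[x_i0, x_l], x_k]], where [k < l]. Its last two indices decrease,
   so in the relation [rel] below it occurs only in the term of the pair [(k, l)], with coefficient
   [a (k, l)] prime to [p]. *)
exists (idx l k l_gt0); set e := (X in span X).
have spne j : j != idx l k l_gt0 -> span e (lamJ t x j).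
  by move=> ne; exact: (span_mem e (exist _ j ne)).
suff spy : span e (lamJ t x (idx l k l_gt0)).
  by move=> j; case: (eqVneq j (idx l k l_gt0)) => [->|/spne].
have rel : \sum_(ij : 'I_d * 'I_d | (ij.1 < ij.2)%N)
    (lam t x i0 ij.2 ij.1 - lam t x i0 ij.1 ij.2) *+ a ij = 0.
  rewrite -[RHS](t_exp_self cl2 tP p_odd (GpD (x i0)) (Dp1 (GpD _))).
  rewrite {1}xpa tz_cprod; apply: eq_bigr => ij _; by rewrite -(lam_jacobi cl2 tP).
(* Monomials whose last two indices increase differ from the eliminated one, or vanish when
   [i = i0]. *)
have sp2 (i j : 'I_d) : (i < j)%N -> span e (lam t x i0 i j).
  move=> ij; have [i_gt0 | ] := ltnP 0 i; last first.
    rewrite leqn0 -i00 => /eqP/val_inj ->.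
    by rewrite /lam commgg (tz1l tP); exact: span0.
  apply: (spne (idx i j i_gt0)); apply/eqP => /(congr1 val) /= [eil ejk].
  by move: ij lt_kl; rewrite eil ejk; lia.
have : span e (lam t x i0 l k *+ a (k, l)).
  have -> : lam t x i0 l k *+ a (k, l) = lam t x i0 k l *+ a (k, l) -
     \sum_(ij : 'I_d * 'I_d | (ij.1 < ij.2)%N && (ij != (k, l)))
       (lam t x i0 ij.2 ij.1 - lam t x i0 ij.1 ij.2) *+ a ij.
    move/eqP: rel; rewrite (bigD1 (k, l)) //= addr_eq0 => /eqP <-.
    by rewrite mulrnBl addrC subrK.
  apply: spanB; first exact/spanMn/sp2.
  apply: span_sum => -[i j] /= /andP[ij ne]; apply/spanMn/spanB/sp2 => //.
  have j_gt0 : (0 < j)%N by apply: leq_ltn_trans ij.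
  apply: (spne (idx j i j_gt0)); apply: contraNneq ne => /(congr1 val) /= [-> ->].
  by [].
have : coprime (a (k, l)) p by rewrite coprime_sym prime_coprime.
have a_gt0 : (0 < a (k, l))%N by case: posnP pa => // ->; rewrite dvdn0.
(* Since [p] kills the monomial, a Bezout relation recovers it from its multiple by [a (k, l)]. *)
case/(coprimeP _ a_gt0) => -[u v] /= uv1 spa.
have -> : lamJ t x (idx l k l_gt0) = lam t x i0 l k *+ (u * a (k, l) - v * p).
  by rewrite uv1.
rewrite mulrnBr; last by rewrite ltnW // -subn_gt0 uv1.
by rewrite [(v * p)%N]mulnC [(u * _)%N]mulnC !mulrnA lam_p mul0rn subr0; exact: spanMn.
Qed.

End CrossedPairingBound.

(** * The tensor square of a group of class 2 *)

Section PresentedGroupTheory.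

Variables (X : choiceType) (rels : word X -> word X -> Prop).

Lemma pres_classM u v :
  pres_class rels u * pres_class rels v = pres_class rels (u ++ v).
Proof. exact: pres_mulE. Qed.

Lemma pres_class_letter x b :
  pres_class rels [:: (x, b)] = if b then pres_gen rels x else (pres_gen rels x)^-1.
Proof.
case: b => //; apply/esym/mulg1_eq; rewrite pres_classM.
exact/pres_classP/pres_eq_cancel.
Qed.

Lemma pres_ind (P : pres_group rels -> Prop) :
  P 1 -> (forall x y, P x -> P y -> P (x * y)) ->
  (forall x, P x -> P x^-1) -> (forall x, P (pres_gen rels x)) -> forall y, P y.
Proof.
move=> P1 PM PV Pgen y; rewrite -[y]pres_reprK.
elim: (pres_repr y) => [//|[x b] w IHw].
rewrite -cat1s -pres_classM; apply: PM => //; rewrite pres_class_letter.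
by case: b => //; apply: PV.
Qed.

Variables (E : groupType) (f : X -> E).

Definition word_eval (w : word X) : E :=
  \prod_(a <- w) (if a.2 then f a.1 else (f a.1)^-1).

Hypothesis f_rels : forall u v, rels u v -> word_eval u = word_eval v.

Definition pres_hom (y : pres_group rels) : E := word_eval (pres_repr y).

Lemma word_eval_pres_eq u v : pres_eq rels u v -> word_eval u = word_eval v.
Proof.
elim=> {u v} [|x b|u u' v v' _ IHu _ IHv|||u v w _ -> _] //.
  rewrite /word_eval big_cons big_seq1 big_nil /=.
  by case: b; rewrite /= ?mulgV ?mulVg.
by rewrite /word_eval !big_cat /= -!/(word_eval _) IHu IHv.
Qed.

Lemma pres_hom_class w : pres_hom (pres_class rels w) = word_eval w.
Proof. exact/word_eval_pres_eq/pres_repr_class. Qed.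

Lemma pres_homM : {morph pres_hom : y z / y * z}.
Proof.
move=> y z; rewrite -[y]pres_reprK -[z]pres_reprK pres_classM !pres_hom_class.
exact: big_cat.
Qed.

Lemma pres_hom_gen x : pres_hom (pres_gen rels x) = f x.
Proof. by rewrite pres_hom_class /word_eval big_seq1. Qed.

End PresentedGroupTheory.

(** Multiplicative, since the target need not be abelian: it will also be a central extension of
    [G]. *)
Definition crossed_pairing_mul (G E : groupType) (f : G -> G -> E) :=
  (forall g g' h, f (g * g') h = f (lconj g g') (lconj g h) * f g h) /\
  (forall g h h', f g (h * h') = f g h * f (lconj h g) (lconj h h')).

Section TensorHom.

Variables (G E : groupType) (f : G -> G -> E).
Hypothesis fP : crossed_pairing_mul f.

Definition tensor_hom : tensor_square G -> E :=
  @pres_hom _ (@tensor_rels G) E (fun x => f x.1 x.2).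

Lemma tensor_hom_rels u v : tensor_rels u v ->
  word_eval (fun x => f x.1 x.2) u = word_eval (fun x => f x.1 x.2) v.
Proof.
by case: fP => [fMl fMr] [] *; rewrite /word_eval !big_cons !big_nil /= !mulg1.
Qed.

Lemma tensor_homM : {morph tensor_hom : x y / x * y}.
Proof. exact/pres_homM/tensor_hom_rels. Qed.

Lemma tensor_homE g h : tensor_hom (tensor g h) = f g h.
Proof. exact: (pres_hom_gen tensor_hom_rels (g, h)). Qed.

End TensorHom.

Section TensorSquareClass2.

Variable G : groupType.

Lemma tensor_crossed : crossed_pairing_mul (@tensor G).
Proof.
split=> g g' h; rewrite /tensor /pres_gen [RHS](pres_classM (@tensor_rels G));
  by apply/pres_classP/pres_eq_rel; constructor.
Qed.

Lemma tensor_ind (P : tensor_square G -> Prop) :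
  P 1 -> (forall x y, P x -> P y -> P (x * y)) ->
  (forall x, P x -> P x^-1) -> (forall g h, P (tensor g h)) -> forall y, P y.
Proof. by move=> P1 PM PV Pt; apply: pres_ind => // -[g h]; apply: Pt. Qed.

Lemma lconjM (g x y : G) : lconj g (x * y) = lconj g x * lconj g y.
Proof. by rewrite /lconj !mulgA mulgVK. Qed.

Lemma lconj_comp (g h x : G) : lconj g (lconj h x) = lconj (g * h) x.
Proof. by rewrite /lconj invMg !mulgA. Qed.

Lemma lconj_lconj (g h x : G) : lconj (lconj g h) (lconj g x) = lconj (g * h) x.
Proof. by rewrite lconj_comp /lconj mulgVK. Qed.

Lemma lconjC : class2 G -> forall g h x : G, lconj (g * h) x = lconj (h * g) x.
Proof.
by move=> cl2 g h x; rewrite !lconjE // !commMgl // (cl2 g x).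
Qed.

(* The idea is to expand [tensor (g * g') (h * h')] in the two possible orders. *)
Lemma tensor_commute : class2 G -> forall a b a' b' : G,
  commute (tensor a b) (tensor a' b').
Proof.
move=> cl2 g h a b; have [tMl tMr] := tensor_crossed.
(* The two expansions differ in the order of [tensor g h] and of a tensor with entries conjugated by
   [g * h]. Applying [c] beforehand turns the latter into [tensor a b]. *)
pose c := lconj (g * h)^-1; have cK y : lconj (g * h) (c y) = y.
  by rewrite lconj_comp mulgV /lconj invg1 mulg1 mul1g.
have := tMl g (c a) (h * c b).
rewrite (tMr (g * c a)) (tMl g (c a) h) (lconjM h) (tMl (lconj h g)).
rewrite (lconjM g) (tMr (lconj g (c a))) (tMr g h) !lconj_lconj.
rewrite !(lconjC cl2 h g) !cK !mulgA => /mulIg.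
by rewrite -!mulgA => /mulgI.
Qed.

Lemma tensor_squareC : class2 G -> forall x y : tensor_square G, x * y = y * x.
Proof.
move=> cl2 x y; rewrite -/(commute x y).
elim/tensor_ind: x => [|x x' cx cx'|x cx|g h].
- exact/commute_sym/commute1.
- exact/commute_sym/commuteM; apply/commute_sym.
- exact/commute_sym/commuteV/commute_sym.
elim/tensor_ind: y => [|y y' cy cy'|y cy|g' h'].
- exact: commute1.
- exact: commuteM.
- exact: commuteV.
exact: tensor_commute.
Qed.

End TensorSquareClass2.

Section Additive.

Variables (X : groupType) (XC : forall x y : X, x * y = y * x).

(** The [let] makes the type depend on the proof of commutativity, from which the instance below is
    built. *)
Definition abelian_zmod : Type := let _ := XC in X.

HB.instance Definition _ := Choice.copy abelian_zmod X.
HB.instance Definition _ := GRing.isZmodule.Build abelian_zmod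
  (@mulgA X) XC (@mul1g X) (@mulVg X).

End Additive.

(** * Central extensions by factor sets *)

Section AbelianQuotient.

Variables (E : groupType) (I : E -> Prop).
Hypothesis I1 : I 1.
Hypothesis IM : forall x y, I x -> I y -> I (x * y).
Hypothesis IV : forall x, I x -> I x^-1.
Hypothesis IR : forall x y, I (x * y * (y * x)^-1).

(** Normality is automatic, as conjugation changes [y] by an element [x * y * (y * x)^-1] of [I]. *)
Lemma abq_conj x y : I y -> I (x * y * x^-1).
Proof.
move=> Iy; have := IM (IR x y) Iy.
by rewrite invMg -!mulgA mulVg mulg1.
Qed.

Definition abq_rel : rel E := fun x y => `[< I (x * y^-1) >].

Lemma abq_relP : equiv_class_of abq_rel.
Proof.
split=> [x|x y|y x z]; first by apply/asboolP; rewrite mulgV.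
  by apply/asboolP/asboolP => /IV; rewrite invMg invgK.
move=> /asboolP xy /asboolP yz; apply/asboolP.
by have := IM xy yz; rewrite mulgA mulgVK.
Qed.

Canonical abq_equiv := EquivRelPack abq_relP.

Definition abq : Type := {eq_quot abq_equiv}%qT.

HB.instance Definition _ := Choice.copy abq {eq_quot abq_equiv}%qT.

Definition abq_pi (x : E) : abq := (\pi_{eq_quot abq_equiv} x)%qT.

Definition abq_repr (x : abq) : E :=
  generic_quotient.repr (x : {eq_quot abq_equiv}%qT).

Lemma abq_piP x y : abq_pi x = abq_pi y <-> I (x * y^-1).
Proof.
split=> [/eqP|Ixy]; first by rewrite eqmodE => /asboolP.
by apply/eqP; rewrite eqmodE; apply/asboolP.
Qed.

Lemma abq_reprK x : abq_pi (abq_repr x) = x.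
Proof. exact: reprK. Qed.

Definition abq_add x y := abq_pi (abq_repr x * abq_repr y).
Definition abq_opp x := abq_pi (abq_repr x)^-1.

Lemma abq_addE x y : abq_add (abq_pi x) (abq_pi y) = abq_pi (x * y).
Proof.
have /abq_piP Ix := abq_reprK (abq_pi x); have /abq_piP Iy := abq_reprK (abq_pi y).
apply/abq_piP; have := IM (abq_conj (abq_repr (abq_pi x)) Iy) Ix.
by rewrite invMg !mulgA mulgVK.
Qed.

Lemma abq_addA : associative abq_add.
Proof.
move=> x y z; rewrite -[x]abq_reprK -[y]abq_reprK -[z]abq_reprK.
by rewrite !abq_addE mulgA.
Qed.

Lemma abq_addC : commutative abq_add.
Proof.
move=> x y; rewrite -[x]abq_reprK -[y]abq_reprK !abq_addE.
exact/abq_piP/IR.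
Qed.

Lemma abq_add0 : left_id (abq_pi 1) abq_add.
Proof. by move=> x; rewrite -[x]abq_reprK abq_addE mul1g. Qed.

Lemma abq_addN : left_inverse (abq_pi 1) abq_opp abq_add.
Proof.
by move=> x; rewrite -{2}[x]abq_reprK /abq_opp abq_addE mulVg.
Qed.

HB.instance Definition _ :=
  GRing.isZmodule.Build abq abq_addA abq_addC abq_add0 abq_addN.

Lemma abelian_quotient : exists (Q : zmodType) (pi : E -> Q),
  (forall x y, pi (x * y) = (pi x + pi y)%R) /\ (forall x, pi x = 0%R <-> I x).
Proof.
exists abq, abq_pi; split=> [x y|x]; first by rewrite -abq_addE.
by rewrite -[0%R]/(abq_pi 1) abq_piP invg1 mulg1.
Qed.

End AbelianQuotient.

Section FactorSet.

Local Open Scope ring_scope.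

Variables (G : groupType) (A : zmodType) (c : G -> G -> A).

(** Normalized 2-cocycles for the trivial action of [G] on [A]. *)
Definition factor_set :=
  [/\ forall g h k, c g h + c (g * h)%g k = c h k + c g (h * k)%g,
      forall g, c 1%g g = 0 & forall g, c g 1%g = 0].

Hypothesis cP : factor_set.

Definition cext : Type := let _ := cP in (A * G)%type.

HB.instance Definition _ := Choice.copy cext (A * G)%type.

Definition cext_mul (x y : cext) : cext :=
  (x.1 + y.1 + c x.2 y.2, (x.2 * y.2)%g).
Definition cext_one : cext := (0, 1%g).
Definition cext_inv (x : cext) : cext :=
  (- x.1 - c x.2 x.2^-1%g, x.2^-1%g).

Lemma cext_mulA : associative cext_mul.
Proof.
case: cP => cM _ _ [a g] [b h] [e k]; rewrite /cext_mul /= mulgA; congr pair.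
rewrite (AC (1*(3)*1) ((1*2*3)*(4*5))) /= -cM.
by rewrite [RHS](AC (3*1*1) ((1*2*4)*(3*5))).
Qed.

Lemma cext_mul1 : left_id cext_one cext_mul.
Proof. by case: cP => _ c1 _ [a g]; rewrite /cext_mul /= c1 mul1g addr0 add0r. Qed.

Lemma cext_mulr1 : right_id cext_one cext_mul.
Proof. by case: cP => _ _ c1 [a g]; rewrite /cext_mul /= c1 mulg1 !addr0. Qed.

Lemma cext_mulrV : right_inverse cext_one cext_inv cext_mul.
Proof. by move=> [a g]; rewrite /cext_mul /= mulgV addrA subrr add0r addNr. Qed.

Lemma cext_mulVr : left_inverse cext_one cext_inv cext_mul.
Proof.
case: cP => cM cl cr [a g]; rewrite /cext_mul /= mulVg; congr pair.
have := cM g g^-1%g g; rewrite mulgV mulVg cl cr !addr0 => ->.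
by rewrite (AC (3*1) ((1*3)*(2*4))) /= !addNr addr0.
Qed.

HB.instance Definition _ := isGroup.Build cext
  cext_mulA cext_mul1 cext_mulr1 cext_mulVr cext_mulrV.

Definition cext_inj (a : A) : cext := (a, 1%g).
Definition cext_sec (g : G) : cext := (0, g).

Lemma cext_mulE (x y : cext) :
  (x * y)%g = (x.1 + y.1 + c x.2 y.2, (x.2 * y.2)%g) :> A * G.
Proof. by []. Qed.

Lemma cext_injD a b : cext_inj (a + b) = (cext_inj a * cext_inj b)%g.
Proof. by case: cP => _ c1 _; rewrite [RHS]cext_mulE /= c1 addr0 mulg1. Qed.

Lemma cext_inj_sec (x : cext) : x = (cext_inj x.1 * cext_sec x.2)%g.
Proof.
by case: cP => _ c1 _; rewrite [RHS]cext_mulE /= c1 !addr0 mul1g; case: x.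
Qed.

Lemma cext_injC a (x : cext) : commute (cext_inj a) x.
Proof.
case: cP => _ c1 cr; rewrite /commute [LHS]cext_mulE [RHS]cext_mulE /= c1 cr.
by rewrite mul1g mulg1 [a + _]addrC.
Qed.

Lemma cext_secM g h :
  (cext_sec g * cext_sec h)%g = (cext_inj (c g h) * cext_sec (g * h))%g.
Proof. by rewrite [LHS]cext_inj_sec cext_mulE /= !add0r. Qed.

(* Not MathComp's [~ x, y], which is x^-1 y^-1 x y. *)
Definition lift_comm (x y : cext) : cext := (x * y * (y * x)^-1)%g.

(** The kernel of the extension is central, so its contributions to the two products cancel: any
    lifts may replace the section. *)
Lemma lift_commE (x y : cext) :
  lift_comm x y = lift_comm (cext_sec x.2) (cext_sec y.2).
Proof.
rewrite {1}[x]cext_inj_sec {1}[y]cext_inj_sec.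
move: (cext_inj _) (cext_injC x.1) (cext_inj _) (cext_injC y.1) => a aC b bC.
move: (cext_sec _) (cext_sec _) => r s; rewrite /lift_comm.
have -> : (a * s * (b * r) = (s * r) * (a * b))%g.
  by rewrite (aC s) -!mulgA; congr (_ * _)%g; rewrite (bC r) mulgA (aC r) -mulgA.
have -> : (b * r * (a * s) = (r * s) * (a * b))%g.
  rewrite (bC r) -!mulgA; congr (_ * _)%g; rewrite (aC s) mulgA (bC s) -mulgA.
  by rewrite (aC b).
by rewrite invMg mulgA mulgK.
Qed.

Lemma lift_comm_sec_lconj g h h' :
  lconj (cext_sec g) (lift_comm (cext_sec h) (cext_sec h')) =
  lift_comm (cext_sec (lconj g h)) (cext_sec (lconj g h')).
Proof.
have sE k : (lconj (cext_sec g) (cext_sec k)).2 = lconj g k by [].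
rewrite -!sE -lift_commE /lift_comm /lconj !invMg !invgK !mulgA.
by rewrite !mulgVK.
Qed.

(** By [lift_commE], [cext_sec (g * g')] may be replaced by the product of the two lifts, for which
    the relation is a commutator identity valid in every group. *)
Lemma lift_comm_crossed :
  crossed_pairing_mul (fun g h => lift_comm (cext_sec g) (cext_sec h)).
Proof.
split=> [g g' h|g h h']; rewrite -lift_comm_sec_lconj.
  have -> : lift_comm (cext_sec (g * g')%g) (cext_sec h) =
      lift_comm (cext_sec g * cext_sec g')%g (cext_sec h) by rewrite [RHS]lift_commE.
  by rewrite /lift_comm /lconj !invMg !mulgA !mulgVK.
have -> : lift_comm (cext_sec g) (cext_sec (h * h')%g) =
    lift_comm (cext_sec g) (cext_sec h * cext_sec h')%g by rewrite [RHS]lift_commE.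
by rewrite /lift_comm /lconj !invMg !mulgA !mulgVK.
Qed.

(** Through this formula the elements of [H' (x) H] reach the 2-chains of the bar complex. *)
Lemma lift_comm_central z g : commute z g ->
  lift_comm (cext_sec z) (cext_sec g) = cext_inj (c z g - c g z).
Proof.
move=> zg; rewrite /lift_comm; apply: (mulIg (cext_sec g * cext_sec z)%g).
rewrite mulgVK !cext_secM mulgA -cext_injD subrK; congr (_ * cext_sec _)%g.
exact: zg.
Qed.

End FactorSet.

(** * The bar complex *)

Section FreeAbelian.

Local Open Scope ring_scope.

Variable X : finType.

Lemma ffun_basisE (f : {ffun X -> int}) : f = \sum_x basis x *~ f x.
Proof.
apply/ffunP => y; rewrite sum_ffunE (bigD1 y) //= big1 => [|x /negPf xy].
  by rewrite addr0 -[RHS]/((basis y *~ f y) y) ffunMzE ffunE eqxx intz.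
by rewrite ffunMzE ffunE eq_sym xy mul0rz.
Qed.

Variables (V : zmodType).

Lemma raddf_basis (h : {additive {ffun X -> int} -> V}) f :
  h f = \sum_x h (basis x) *~ f x.
Proof.
by rewrite {1}[f]ffun_basisE raddf_sum; apply: eq_bigr => x _; rewrite raddfMz.
Qed.

Definition basis_lin (F : X -> V) (f : {ffun X -> int}) : V :=
  \sum_x F x *~ f x.

Lemma basis_lin_is_zmod_morphism F : zmod_morphism (basis_lin F).
Proof.
by move=> a b; rewrite -sumrB; apply: eq_bigr => x _; rewrite !ffunE mulrzBr.
Qed.

HB.instance Definition _ F := GRing.isZmodMorphism.Build
  {ffun X -> int} V (basis_lin F) (basis_lin_is_zmod_morphism F).

Lemma basis_linE F x : basis_lin F (basis x) = F x.
Proof.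
rewrite /basis_lin (bigD1 x) //= ffunE eqxx mulr1z big1 ?addr0 // => y /negPf yx.
by rewrite ffunE yx mulr0z.
Qed.

End FreeAbelian.

Section BarComplex.

Local Open Scope ring_scope.

Variable G : finGroupType.

Lemma bar_d2_basis (g h : G) :
  bar_d2 (basis (g, h)) = basis h - basis (g * h)%g + basis g.
Proof.
rewrite /bar_d2 -(basis_linE (fun x : G * G =>
  basis x.2 - basis (x.1 * x.2)%g + basis x.1) (g, h)).
by apply: eq_bigr => -[].
Qed.

Lemma bar_d3_basis (g h k : G) : bar_d3 (basis (g, h, k)) =
  basis (h, k) - basis ((g * h)%g, k) + basis (g, (h * k)%g) - basis (g, h).
Proof.
rewrite /bar_d3 -(basis_linE (fun x : G * G * G =>
  basis (x.1.2, x.2) - basis ((x.1.1 * x.1.2)%g, x.2)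
    + basis (x.1.1, (x.1.2 * x.2)%g) - basis x.1) (g, h, k)).
by apply: eq_bigr => -[[]].
Qed.

(** The same boundaries as in [boundary2], but inside all 2-chains: every symbol [(g, h)] then has a
    class in the quotient [bar_quot]. *)
Definition bar_boundary : {pred {ffun G * G -> int}} :=
  fun c => `[< exists e, c = bar_d3 e >].

Lemma bar_boundary_closed : zmod_closed bar_boundary.
Proof.
split=> [|a b /asboolP [c ->] /asboolP [e ->]]; apply/asboolP.
  by exists 0; rewrite raddf0.
by exists (c - e); rewrite raddfB.
Qed.

HB.instance Definition _ :=
  GRing.isZmodClosed.Build {ffun G * G -> int} bar_boundary bar_boundary_closed.

Definition bar_quot : zmodType := Quotient.quot bar_boundary.

Definition bar_pi (c : {ffun G * G -> int}) : bar_quot :=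
  (\pi_(Quotient.quot bar_boundary) c)%qT.

Lemma bar_pi_is_zmod_morphism : zmod_morphism bar_pi.
Proof. by move=> a b; rewrite /bar_pi !piE. Qed.

HB.instance Definition _ := GRing.isZmodMorphism.Build
  {ffun G * G -> int} bar_quot bar_pi bar_pi_is_zmod_morphism.

Lemma bar_pi_eq0 c : bar_pi c = 0 <-> exists e, c = bar_d3 e.
Proof.
rewrite -(raddf0 bar_pi) /bar_pi; split=> [/eqP|ce].
  by rewrite -Quotient.idealrBE subr0 => /asboolP.
by apply/eqP; rewrite -Quotient.idealrBE subr0; apply/asboolP.
Qed.

Definition schur_pi (z : Z2 G) : schur_multiplier G :=
  (\pi_(Quotient.quot (boundary2 (G := G))) z)%qT.

Lemma schur_pi_is_zmod_morphism : zmod_morphism schur_pi.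
Proof. by move=> a b; rewrite /schur_pi !piE. Qed.

HB.instance Definition _ := GRing.isZmodMorphism.Build
  (Z2 G) (schur_multiplier G) schur_pi schur_pi_is_zmod_morphism.

Lemma schur_pi_surj m : exists z, schur_pi z = m.
Proof. by exists (generic_quotient.repr m); apply: reprK. Qed.

(** The Schur multiplier thus embeds in [bar_quot], where the computations take place. *)
Lemma schur_pi_eq0 z : schur_pi z = 0 <-> bar_pi (\val z) = 0.
Proof.
rewrite bar_pi_eq0 -(raddf0 schur_pi) /schur_pi; split=> [/eqP|ze].
  by rewrite -Quotient.idealrBE subr0 => /asboolP.
by apply/eqP; rewrite -Quotient.idealrBE subr0; apply/asboolP.
Qed.

Definition bracket (g h : G) : bar_quot := bar_pi (basis (g, h)).

Lemma bracket_cocycle g h k :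
  bracket g h + bracket (g * h)%g k = bracket h k + bracket g (h * k)%g.
Proof.
have : bar_pi (bar_d3 (basis (g, h, k))) = 0 by apply/bar_pi_eq0; exists (basis (g, h, k)).
rewrite bar_d3_basis raddfB raddfD raddfB => /eqP.
by rewrite subr_eq0 addrAC subr_eq => /eqP <-.
Qed.

(** The cocycle identity gives [bracket 1 g = bracket 1 1 = bracket g 1], so subtracting this
    constant normalizes [bracket]. *)
Definition bar_fs (g h : G) : bar_quot := bracket g h - bracket 1%g 1%g.

Lemma bar_fsP : factor_set bar_fs.
Proof.
split=> [g h k|g|g]; rewrite /bar_fs.
- by rewrite addrACA bracket_cocycle -addrACA.
- have := bracket_cocycle 1%g 1%g g; rewrite !mul1g => /addIr ->.
  exact: subrr.
have := bracket_cocycle g 1%g 1%g; rewrite !mulg1 addrC => /addIr ->.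
exact: subrr.
Qed.

Definition bar_ext : groupType := cext bar_fsP.

Definition bar_tensor_hom : tensor_square G -> bar_ext :=
  tensor_hom (fun g h => lift_comm (cext_sec bar_fsP g) (cext_sec bar_fsP h)).

Lemma bar_tensor_homM : {morph bar_tensor_hom : x y / (x * y)%g}.
Proof. exact/tensor_homM/lift_comm_crossed. Qed.

Lemma bar_tensor_homE g h : bar_tensor_hom (tensor g h) =
  lift_comm (cext_sec bar_fsP g) (cext_sec bar_fsP h).
Proof. exact: (tensor_homE (lift_comm_crossed bar_fsP)). Qed.

(* Hopf's argument: the abelianization of the extension is a quotient of the
   free abelian group on [G], compatibly with [bar_d2], so a cycle dies there. *)
Lemma cycle2_tensor c : bar_d2 c = 0 ->
  exists x, bar_tensor_hom x = cext_inj bar_fsP (bar_pi c).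
Proof.
move=> c0; pose I e := exists x, bar_tensor_hom x = e.
have I1 : I 1%g.
  exists 1%g; apply: (mulIg (bar_tensor_hom 1%g)).
  by rewrite -bar_tensor_homM !mul1g.
have IM x y : I x -> I y -> I (x * y)%g.
  by move=> [u <-] [v <-]; exists (u * v)%g; apply: bar_tensor_homM.
have IV x : I x -> I x^-1%g.
  move=> [u <-]; exists u^-1%g; case: I1 => v v1.
  have e1 : bar_tensor_hom 1%g = 1%g.
    by apply: (mulIg (bar_tensor_hom 1%g)); rewrite -bar_tensor_homM !mul1g.
  by apply: (mulIg (bar_tensor_hom u)); rewrite -bar_tensor_homM !mulVg.
have IR x y : I (x * y * (y * x)^-1)%g.
  exists (tensor x.2 y.2); rewrite bar_tensor_homE -lift_commE //.
have [Q [f [fM f0]]] := abelian_quotient I1 IM IV IR.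
apply/f0; pose inj a := f (cext_inj bar_fsP a).
have injD a b : inj (a + b) = inj a + inj b by rewrite /inj cext_injD fM.
have inj_zmod : zmod_morphism (inj \o bar_pi).
  move=> a b /=; apply: (addIr (inj (bar_pi b))).
  by rewrite -injD raddfB !subrK.
(* Adding the constant subtracted in [bar_fs] gives [inj_brk] exactly the shape of [bar_d2]. *)
pose r g := f (cext_sec bar_fsP g) + inj (bracket 1%g 1%g).
have inj_brk g h : inj (bracket g h) = r h - r (g * h)%g + r g.
  have := congr1 f (cext_secM bar_fsP g h); rewrite !fM -/(inj _) /bar_fs => e.
  have -> : bracket g h = bracket g h - bracket 1%g 1%g + bracket 1%g 1%g.
    by rewrite subrK.
  rewrite injD; apply: (addIr (f (cext_sec bar_fsP (g * h)%g))).
  rewrite addrAC -e /r opprD.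
  by rewrite [RHS](AC ((2*2)*2*1) ((5*1)*(2*4)*6*(3*7))) /= subrr addNr !addr0.
pose h : {additive {ffun G * G -> int} -> Q} :=
  HB.pack (inj \o bar_pi) (GRing.isZmodMorphism.Build _ _ (inj \o bar_pi) inj_zmod).
(* By [inj_brk], [inj \o bar_pi] is [basis_lin r] after [bar_d2], and so vanishes on cycles. *)
rewrite -[f _]/(h c) raddf_basis; transitivity (basis_lin r (bar_d2 c)); last first.
  by rewrite c0 raddf0.
rewrite -[RHS]/((basis_lin r \o @bar_d2 G) c) raddf_basis.
apply: eq_bigr => -[g k] _; congr (_ *~ _).
rewrite /= inj_brk bar_d2_basis.
by rewrite (raddfD (basis_lin r)) (raddfB (basis_lin r)) /= !basis_linE.
Qed.

(** The cocycle identity says that [chi], extended to chains, kills boundaries. Cocycles can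
    therefore detect nonzero elements of [bar_quot]. *)
Lemma basis_lin_cocycle (V : zmodType) (chi : G -> G -> V) c :
  (forall g h k, chi g h + chi (g * h)%g k = chi h k + chi g (h * k)%g) ->
  bar_pi c = 0 -> basis_lin (fun x => chi x.1 x.2) c = 0.
Proof.
move=> chiP /bar_pi_eq0[e ->]; set F := basis_lin _.
rewrite -[LHS]/((F \o @bar_d3 G) e) raddf_basis big1 // => -[[g h] k] _.
rewrite /= bar_d3_basis (raddfB F) (raddfD F) (raddfB F) /= /F !basis_linE /=.
rewrite (AC 4 ((1*3)*(2*4))) /= -chiP -opprD [X in _ - X]addrC subrr mul0rz.
by [].
Qed.

End BarComplex.

(** * Special p-groups and the Magnus embedding *)

(** Representatives of generators of the quotient generate [G] together with ['Phi(G)], whose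
    elements are non-generators. *)
Lemma leq_grank_quotient_Phi (gT : finGroupType) (G : {group gT}) :
  'm(G) <= 'm(G / 'Phi(G)).
Proof.
have [B genB <-] := grank_witness (G / 'Phi(G)).
have sBG : B \subset G / 'Phi(G) by rewrite -genB subset_gen.
apply: leq_trans (leq_imset_card (fun b : coset_of 'Phi(G) => repr b) B).
pose C : {set gT} := (fun b : coset_of 'Phi(G) => repr b) @: B; rewrite -/C.
have CG : C \subset G.
  apply/fintype.subsetP => _ /imsetP[b bB ->].
  suff: repr b \in coset 'Phi(G) @*^-1 (G / 'Phi(G)) by rewrite quotientGK ?Phi_normal.
  apply/morphpreP; split; first exact: repr_coset_norm.
  by rewrite /= coset_reprK (fintype.subsetP sBG).
have nC : C \subset 'N('Phi(G)) by apply: fintype.subset_trans CG (normal_norm (Phi_normal G)).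
have CB : C / 'Phi(G) = B.
  rewrite [LHS]morphimEsub // -imset_comp -[RHS]imset_id.
  by apply: eq_imset => b /=; rewrite coset_reprK.
suff /Phi_nongen <- : 'Phi(G) <*> C = G by exact: grank_min.
apply/eqP; rewrite finset.eqEsubset join_subG Phi_sub CG /=.
apply: fintype.subset_trans (_ : 'Phi(G) * <<C>> \subset _); last first.
  by rewrite mul_subG ?joing_subl // gen_subG joing_subr.
by rewrite -quotientSK ?normal_norm ?Phi_normal // quotient_gen // CB genB.
Qed.

Lemma special_pgroup_facts (gT : finGroupType) (p d : nat) : prime p ->
  special_pgroup p [set: gT] -> 'm([set: gT]) = d ->
  [/\ class2 gT, forall g : gT, g ^+ p \in [set: gT]^`(1),
      forall z, z \in [set: gT]^`(1) -> z ^+ p = 1,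
      exists x : 'I_d -> gT, <<[set x i | i : 'I_d]>> = [set: gT]
    & p ^ d * #|[set: gT]^`(1)| <= #|[set: gT]| ].
Proof.
move=> p_pr [pG _ [PhiG derG] abG] mG; split.
- move=> x y z; have: [~ x, y] \in 'Z([set: gT]).
    by rewrite -derG derg1 mem_commg ?inE.
  by case/centerP => _; apply; rewrite inE.
- move=> g; rewrite derG -PhiG (Phi_joing pG).
  apply: (fintype.subsetP (joing_subr _ _)); rewrite -[p]expn1; apply: Mho_p_elt.
    by rewrite inE.
  by apply: mem_p_elt pG _; rewrite inE.
- by case/and3P: abG => _ _ /exponentP.
- have [B genB cB] := grank_witness [set: gT]; rewrite mG in cB.
  exists (fun i => enum_val (cast_ord (esym cB) i)); rewrite -[RHS]genB.
  congr <<_>>; apply/finset.setP=> b; apply/imsetP/idP => [[i _ ->]|bB].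
    exact: enum_valP.
  exists (cast_ord cB (enum_rank_in bB b)) => //.
  by rewrite cast_ordK enum_rankK_in.
(* The Frattini quotient is elementary abelian, and its rank is at least ['m([set: gT])] by
   [leq_grank_quotient_Phi]. *)
have abq := Phi_quotient_abelem pG; rewrite -mG.
rewrite -[leqRHS](Lagrange (Phi_sub [set: gT]%G)) derG -PhiG.
rewrite mulnC leq_mul2l -card_quotient ?normal_norm ?Phi_normal //.
apply/orP; right; rewrite (card_pgroup (abelem_pgroup abq)) leq_exp2l ?prime_gt1 //.
by rewrite -(rank_abelem abq) -grank_abelian ?(abelem_abelian abq) ?leq_grank_quotient_Phi.
Qed.

Lemma card_lt_pairs d : #|[pred ij : 'I_d * 'I_d | ij.1 < ij.2]| = 'C(d, 2).
Proof.
rewrite -sum1_card -bin2_sum big_mkord /=.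
under [RHS]eq_bigr => j _ do rewrite -[nat_of_ord j]card_ord -sum1_card
  (big_ord_widen d (fun=> 1%N)) ?(ltnW (ltn_ord j)) //.
rewrite (exchange_big_dep xpredT) //= pair_big_dep /=.
by apply: eq_bigl => -[i j].
Qed.

Section Class2Bound.

Variables (gT : finGroupType) (p d : nat) (y : 'I_d -> gT) (D : {group gT}).
Hypothesis p_pr : prime p.
Hypothesis cl2 : class2 gT.
Hypothesis expp : forall g : gT, g ^+ p = 1.
Hypothesis D_gen : <<[set y i | i : 'I_d]>> = D :> {set gT}.

(** [S] generates a central subgroup on at most ['C(d, 2)] generators, modulo which [D] is abelian
    on at most [d] generators; both have exponent dividing [p]. *)
Lemma class2_card_bound : #|D| <= p ^ (d + 'C(d, 2)).
Proof.
pose S : {set gT} := [set [~ y ij.1, y ij.2] | ij in [pred ij : 'I_d * 'I_d | ij.1 < ij.2]].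
have card_abelem (rT : finGroupType) (K : {group rT}) :
    (forall g : rT, g \in K -> g ^+ p = 1) ->
    abelian K -> #|K| = (p ^ 'm(K))%N.
  move=> Kp abK; have abeK : p.-abelem K by apply/(abelemP p_pr).
  by rewrite grank_abelian // (rank_abelem abeK) -card_pgroup // abelem_pgroup.
have Scent g h : g \in S -> commute g h.
  by case/imsetP => ij _ ->; apply: cl2.
have Kcent g h : g \in <<S>> -> commute g h.
  move: g; apply: gen_ind => [|a b aS _ bh]; first exact/commute_sym/commute1.
  by apply/commute_sym/commuteM; apply/commute_sym => //; apply: Scent.
have nK (A : {set gT}) : A \subset 'N(<<S>>).
  by apply/cents_norm/fintype.subsetP => g _; apply/centP => h hS; apply/commute_sym/Kcent.
have yS i j : [~ y i, y j] \in <<S>>.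
  have lt (k l : 'I_d) : k < l -> [~ y k, y l] \in <<S>>.
    by move=> kl; apply/mem_gen/imsetP; exists (k, l).
  case: (ltngtP i j) => [||/val_inj ->]; first exact: lt.
    by move=> ji; rewrite -invgR groupV lt.
  by rewrite commgg group1.
have sSD : <<S>> \subset D.
  rewrite gen_subG -D_gen; apply/fintype.subsetP => _ /imsetP[ij _ ->].
  by rewrite groupR ?mem_gen ?imset_f.
have abQ : abelian (D / <<S>>).
  rewrite -D_gen quotient_gen // abelian_gen.
  apply/fintype.subsetP => _ /morphimP[a Na /imsetP[i _ ea] ->].
  apply/centP => _ /morphimP[b Nb /imsetP[j _ eb] ->]; apply/commgP.
  by rewrite -morphR //= coset_id // ea eb.
have mD : 'm(D) <= d.
  by rewrite -D_gen (leq_trans (grank_min _)) // (leq_trans (leq_imset_card _ _)) ?card_ord.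
have mS : 'm(<<S>>) <= 'C(d, 2).
  rewrite (leq_trans (grank_min _)) // (leq_trans (leq_imset_card _ _)) //.
  by rewrite card_lt_pairs.
rewrite -(Lagrange sSD) -card_quotient // (card_abelem _ <<S>>%G) //; last first.
  by rewrite abelian_gen; apply/fintype.subsetP => g gS; apply/centP => h hS; apply: Scent.
rewrite (card_abelem _ (D / <<S>>)%G) // => [|_ /morphimP[g Ng _ ->]]; last first.
  by rewrite -morphX // expp morph1.
rewrite -expnD leq_exp2l ?prime_gt1 // addnC leq_add //.
exact: leq_trans (quotient_grank _) mD.
Qed.

End Class2Bound.

(** * The group of truncated Magnus units *)

Section MagnusGroup.

Local Open Scope ring_scope.

Variables (p d : nat).
Hypothesis p_pr : prime p.

(** The matrix of [v (x) w], the degree 2 part of the product of [1 + v] and [1 + w]. *)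
Definition magnus_cocycle (v w : Algebra.to_multiplicative 'rV['F_p]_d) :
  'M['F_p]_d := (v : 'rV_d)^T *m (w : 'rV_d).

Lemma magnus_factor_set : factor_set magnus_cocycle.
Proof.
split=> [v w u|v|v]; rewrite /magnus_cocycle; last 2 first.
- by rewrite -[1%g]/(0 : 'rV_d) trmx0 mul0mx.
- by rewrite -[1%g]/(0 : 'rV_d) mulmx0.
have mulD (a b e : 'rV['F_p]_d) :
    a^T *m b + (a + b)^T *m e = b^T *m e + a^T *m (b + e).
  by rewrite linearD mulmxDl mulmxDr addrA [RHS]addrC.
exact: mulD.
Qed.

(* Truncated tensor algebra: [(q, v)] stands for [1 + v + q] modulo degree 3. *)
Definition magnus : Type := cext magnus_factor_set.

HB.instance Definition _ := Finite.copy magnus ('M['F_p]_d * 'rV['F_p]_d)%type.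
HB.instance Definition _ := Group.copy magnus (cext magnus_factor_set).

Definition magnus_gen (i : 'I_d) : magnus := (0, delta_mx 0 i).

Lemma magnus_class2 : class2 magnus.
Proof.
move=> x y z; have -> : [~ x, y]%g = cext_inj magnus_factor_set [~ x, y]%g.1.
  rewrite {1}[[~ x, y]%g](cext_inj_sec (cP := magnus_factor_set)).
  have -> : [~ x, y]%g.2 = 1%g :> Algebra.to_multiplicative _.
    rewrite -[LHS]/([~ x.2, y.2]%g); apply/eqP/commgP.
    exact: (@addrC 'rV['F_p]_d).
  by rewrite -[RHS]mulg1.
exact: cext_injC.
Qed.

Lemma Fp_natmul (M : 'M['F_p]_d) : M *+ p = 0.
Proof. by rewrite -scaler_nat pchar_Fp_0 // scale0r. Qed.

(** [xE] is the binomial expansion of the [n]-th power of [1 + v + q] modulo degree 3; an odd [p]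
    divides ['C(p, 2)]. *)
Lemma magnus_expp : odd p -> forall x : magnus, (x ^+ p = 1)%g.
Proof.
move=> p_odd x.
have xE (q : 'M['F_p]_d) (v : 'rV['F_p]_d) n : (((q, v) : magnus) ^+ n)%g =
    (q *+ n + (v^T *m v) *+ 'C(n, 2), v *+ n) :> 'M['F_p]_d * 'rV['F_p]_d.
  elim: n => [|n IHn]; first by rewrite !mulr0n addr0.
  have -> : (((q, v) : magnus) ^+ n.+1)%g = (q + (q *+ n + (v^T *m v) *+ 'C(n, 2))
      + v^T *m (v *+ n), v + v *+ n) :> 'M['F_p]_d * 'rV['F_p]_d.
    by rewrite expgS [(_ ^+ n)%g]IHn.
  congr pair; last by rewrite mulrS.
  rewrite mulrS -!addrA binS bin1 mulrnDr; do 3!congr (_ + _).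
  by rewrite -scaler_nat -scalemxAr scaler_nat.
case: x => q v; rewrite [LHS](xE q v) bin2odd // mulrnA.
rewrite ![_ *+ p]Fp_natmul mul0rn addr0.
by rewrite -[(v : 'rV['F_p]_d) *+ p]scaler_nat pchar_Fp_0 // scale0r.
Qed.

End MagnusGroup.

Section MagnusEmbedding.

Variables (p d : nat) (gT : finGroupType) (x : 'I_d -> gT).
Hypothesis p_pr : prime p.
Hypothesis p_odd : odd p.
Hypothesis cl2 : class2 gT.
Hypothesis expp : forall g : gT, g ^+ p = 1.
Hypothesis x_gen : <<[set x i | i : 'I_d]>> = [set: gT].
Hypothesis oG : p ^ (d + 'C(d, 2)) <= #|[set: gT]|.

(* The subgroup of [gT * magnus p d] generated by the pairs of generators has class
   2 and exponent p, hence is no larger than [gT]: it is the graph of a function. *)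
Lemma magnus_embedding : exists f : gT -> magnus p d,
  (forall g h, f (g * h) = f g * f h) /\ (forall i, f (x i) = magnus_gen p i).
Proof.
pose y i : (gT * magnus p d)%type := (x i, magnus_gen p i).
pose D := <<[set y i | i : 'I_d]>>%G.
have cl2P : class2 (gT * magnus p d)%type.
  move=> a b c; rewrite /commute.
  rewrite -[LHS]/([~ a.1, b.1] * c.1, [~ a.2, b.2] * c.2).
  rewrite -[RHS]/(c.1 * [~ a.1, b.1], c.2 * [~ a.2, b.2]).
  by congr pair; [exact: cl2 | exact: magnus_class2].
have exppP (a : (gT * magnus p d)%type) : a ^+ p = 1.
  have aX n : a ^+ n = (a.1 ^+ n, a.2 ^+ n).
    by elim: n => [//|n IHn]; rewrite !expgS IHn.
  by rewrite aX expp magnus_expp.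
have oD : #|D| <= p ^ (d + 'C(d, 2)) by apply: (class2_card_bound (y := y)).
have exD g : exists u, (g, u) \in D.
  move: g; apply: (gen_x x_gen) => [|i g [u Du]]; first by exists 1; exact: group1.
  exists (magnus_gen p i * u).
  have Dy : y i \in D by apply/mem_gen/imset_f.
  exact: (groupM Dy Du).
have inj1 : {in D &, injective (@fst gT (magnus p d))}.
  apply/imset_injP; rewrite eqn_leq leq_imset_card (leq_trans oD) //.
  rewrite (leq_trans oG) // subset_leq_card //; apply/fintype.subsetP => g _.
  by have [u Du] := exD g; apply/imsetP; exists (g, u).
have [f Df] := fin_all_exists exD.
have fE g u : (g, u) \in D -> f g = u.
  by move=> Du; have /(congr1 snd) := inj1 _ _ (Df g) Du erefl.
exists f; split=> [g h|i]; apply: fE; first exact: groupM (Df g) (Df h).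
by apply/mem_gen/imsetP; exists i.
Qed.

End MagnusEmbedding.

(** * Counting and elementary abelian groups *)

Section Counting.

Local Open Scope nat_scope.

Lemma sum_ord_geq d m : \sum_(j < d | m <= j) 1 = d - m.
Proof.
elim: d => [|d IHd]; first by rewrite big_ord0.
by rewrite big_mkcond big_ord_recr /= -big_mkcond /= IHd; case: leqP; lia.
Qed.

(** With first index [i] there are [d - i.+1] choices for the second and [d - i] for the third;
    reversing the order of the indices yields the sum of [i * i.+1]. *)
Lemma card_lie_index d : 3 * #|{: lie_index d}| = d ^ 3 - d.
Proof.
rewrite card_sig -sum1_card.
have -> : \sum_(x in [pred x : 'I_d * 'I_d * 'I_d | (x.1.1 < x.1.2) && (x.1.1 <= x.2)]) 1
    = \sum_(i < d) (d - i.+1) * (d - i).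
  under [RHS]eq_bigr => i _ do
    rewrite -(sum_ord_geq d i.+1) -(sum_ord_geq d i) big_distrl /=.
  under [RHS]eq_bigr => i _ do under eq_bigr => j _ do rewrite mul1n.
  by rewrite pair_big_dep /= pair_big_dep /=; apply: eq_bigl => -[[i j] k].
have -> : \sum_(i < d) (d - i.+1) * (d - i) = \sum_(i < d) i * i.+1.
  rewrite (reindex_inj rev_ord_inj) /=; apply: eq_bigr => i _.
  by have lt_i := ltn_ord i; have [-> ->] :
    (d - (d - i.+1).+1 = i) /\ (d - (d - i.+1) = i.+1) by split; lia.
elim: d => [|d IHd]; first by rewrite big_ord0.
by rewrite big_ord_recr /= mulnDr IHd; nia.
Qed.

Lemma card_sym_index d : #|{: sym_index d}| = 'C(d.+1, 2).
Proof.
rewrite card_sig -sum1_card -bin2_sum big_mkord.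
rewrite [RHS]big_ord_recl add0n; transitivity (\sum_(i < d) (d - i)).
  under [RHS]eq_bigr => i _ do rewrite -(sum_ord_geq d i).
  by rewrite pair_big_dep; apply: eq_bigl => -[i j].
rewrite (reindex_inj rev_ord_inj) /=; apply: eq_bigr => i _.
by have := ltn_ord i; rewrite /bump /=; lia.
Qed.

Lemma tensor_rank_sum d : (0 < d)%N ->
  d * (d ^ 2 + 3 * d - 1) %/ 3 = d * d + #|{: lie_index d}|.
Proof.
move=> d_gt0; have L := card_lie_index d.
have -> : d * (d ^ 2 + 3 * d - 1) = (d * d + #|{: lie_index d}|) * 3.
  by rewrite mulnDl [#|_| * 3]mulnC L; nia.
by rewrite mulnK.
Qed.

(** The ranks of [H'] and of nabla add up to the number of tensors [x_i (x) x_j]. *)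
Lemma bin2_sqr d : 'C(d, 2) + 'C(d.+1, 2) = d * d.
Proof. by rewrite binS bin1 addnA addnn -mul2n mul_bin_left ?bin1; nia. Qed.

End Counting.

Lemma isomorphic_morph (X Y : groupType) (f : X -> Y) :
  {morph f : x y / x * y} -> bijective f -> isomorphic X Y.
Proof.
move=> fM bij_f.
pose F : {multiplicative X -> Y} := HB.pack f (isMultiplicative.Build _ _ f fM).
by exists F.
Qed.

Lemma isomorphic_sym (X Y : groupType) : isomorphic X Y -> isomorphic Y X.
Proof.
move=> [f [g fK gK]]; apply: (isomorphic_morph (f := g)); last by exists f.
by move=> x y; apply: (can_inj fK); rewrite gmulfM !gK.
Qed.

Lemma isomorphic_trans (X Y Z : groupType) :
  isomorphic X Y -> isomorphic Y Z -> isomorphic X Z.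
Proof.
move=> [f bij_f] [g bij_g]; apply: (isomorphic_morph (f := g \o f)).
  by move=> x y /=; rewrite !gmulfM.
exact: bij_comp.
Qed.

Lemma isomorphic_prod_Zp (X Y : groupType) p a b :
  isomorphic X (Zp_power p a) -> isomorphic Y (Zp_power p b) ->
  isomorphic (X * Y)%type (Zp_power p (a + b)).
Proof.
move=> [f [f' fK f'K]] [g [g' gK g'K]].
apply: (isomorphic_morph
  (f := fun x => row_mx (f x.1 : 'rV_a) (g x.2 : 'rV_b) : Zp_power p (a + b))).
  move=> x y; rewrite [f _]gmulfM [g _]gmulfM.
  exact/esym/add_row_mx.
exists (fun u : 'rV_(a + b) => (f' (lsubmx u), g' (rsubmx u))).
  by move=> [x y] /=; rewrite row_mxKl row_mxKr fK gK.
by move=> u /=; rewrite f'K g'K hsubmxK.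
Qed.

(** * Recognizing a power of the cyclic group of order [p] from a basis *)

Section ZpBasis.

Local Open Scope ring_scope.

Variables (p : nat) (X : groupType) (A : zmodType) (f : X -> A).
Variables (I : finType) (e : I -> A).
Hypothesis p_pr : prime p.
Hypothesis fM : forall x y, f (x * y)%g = f x + f y.
Hypothesis f_inj : injective f.
Hypothesis f_span : forall x, span e (f x).
Hypothesis e_f : forall i, exists x, f x = e i.
Hypothesis e_p : forall i, e i *+ p = 0.
Hypothesis e_indep : forall u : I -> 'F_p, \sum_i e i *+ u i = 0 -> u =1 fun=> 0.

Let comb (u : 'rV['F_p]_#|I|) : A := \sum_i e i *+ u 0 (enum_rank i).

Lemma mulrn_modp i n : e i *+ (n %% p) = e i *+ n.
Proof. by rewrite {2}(divn_eq n p) mulrnDr mulnC mulrnA e_p mul0rn add0r. Qed.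

Lemma mulrn_FpD i (a b : 'F_p) : e i *+ (a + b)%R = e i *+ a + e i *+ b.
Proof.
have -> : nat_of_ord (a + b)%R = ((a + b) %% p)%N.
  by rewrite /=; congr (_ %% _)%N; exact: Fp_cast.
by rewrite mulrn_modp mulrnDr.
Qed.

Lemma combD u v : comb (u + v) = comb u + comb v.
Proof.
rewrite -big_split; apply: eq_bigr => i _.
by rewrite mxE mulrn_FpD.
Qed.

(** [X] is seen through its image under [f], which need not be all of [A]: a subgroup such as nabla
    can use a basis written in the ambient group. *)
Lemma Zp_basis_isomorphic : isomorphic X (Zp_power p #|I|).
Proof.
have in_f a : span e a -> exists x, f x = a.
  have f1 : f 1%g = 0 by apply: gadd1 fM.
  move=> [c ->]; apply: (big_ind (fun a => exists x, f x = a)).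
  - by exists 1%g.
  - by move=> _ _ [x <-] [y <-]; exists (x * y)%g.
  move=> i _; have [x <-] := e_f i; case: (c i) => n.
    by exists (x ^+ n)%g; rewrite (gaddX fM).
  by exists (x ^+ n.+1)^-1%g; rewrite (gaddV fM) (gaddX fM).
have [g gE] : {g : 'rV['F_p]_#|I| -> X & forall u, f (g u) = comb u}.
  apply: (@choice _ _ (fun u x => f x = comb u)) => u; apply: in_f.
  by apply: span_sum => i _; apply/spanMn/span_mem.
apply: isomorphic_sym; apply: (isomorphic_morph (f := g : Zp_power p #|I| -> X)).
  by move=> u v; apply: f_inj; rewrite fM !gE combD.
have g_inj : injective g.
  move=> u v uv; have : comb (u - v) = 0.
    by apply: (addIr (comb v)); rewrite -combD subrK add0r -!gE uv.
  pose w i := (u - v) 0 (enum_rank i) => /(e_indep (u := w)) w0.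
  apply/rowP => i; apply/eqP; rewrite -subr_eq0.
  by have := w0 (enum_val i); rewrite /w enum_valK !mxE => ->.
have g_surj x : exists u, g u = x.
  have [c cE] := span_modp e_p (prime_gt0 p_pr) (f_span x).
  exists (\row_i (c (enum_val i))%:R); apply: f_inj; rewrite gE cE.
  apply: eq_bigr => i _; rewrite mxE enum_rankK val_Fp_nat //.
  by rewrite mulrn_modp.
have [h hE] := choice g_surj.
by exists h => [u|x]; [apply: g_inj; rewrite hE | rewrite hE].
Qed.

End ZpBasis.

Lemma abelem_isomorphic (gT : finGroupType) (K : {group gT}) p k :
  prime p -> p.-abelem K -> #|K| = (p ^ k)%N -> 0 < k ->
  isomorphic (subg_of K) (Zp_power p k).
Proof.
move=> p_pr abK oK k_gt0.
have ntK : K :!=: 1 by rewrite -cardG_gt1 oK -(exp1n k) ltn_exp2r ?prime_gt1.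
have dimK : (abelem_dim' K).+1 = k.
  by rewrite (dim_abelemE abK ntK) oK pfactorK.
rewrite -dimK.
apply: (isomorphic_morph
  (f := fun x : subg_of K => abelem_rV abK ntK (sgval x) : Zp_power p (abelem_dim' K).+1)).
  by move=> x y; rewrite /= morphM ?subgP.
exists (fun u : 'rV['F_p]_(abelem_dim' K).+1 => subg K (rVabelem abK ntK u)).
  by move=> x; rewrite abelem_rV_K ?subgP ?sgvalK.
by move=> u; rewrite subgK ?mem_rVabelem ?rVabelemK.
Qed.

(** * The tensor square and the multiplier *)

Lemma card_le_finType (F : finType) (T : Type) (f : F -> T) :
  (forall y, exists u, f u = y) -> ([set: T] #<= `I_#|F|)%card.
Proof.
move=> f_surj; have -> : [set: T]%classic = (f @` [set: F])%classic.
  by apply/seteqP; split=> y // _; have [u <-] := f_surj y; exists u.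
apply: card_le_trans (card_image_le _ _) _.
have : ([set: F] #<= (enum_val @` [set: 'I_#|F|]))%card.
  apply: subset_card_le => u _; exists (enum_rank u) => //; exact: enum_rankK.
move=> /card_le_trans; apply; apply: card_le_trans (card_image_le _ _) _.
by have := @card_II #|F|; rewrite card_eq_le => /andP[].
Qed.

Section SpecialTensor.

Local Open Scope ring_scope.

Variables (G : finGroupType) (p d : nat) (x : 'I_d -> G).
Hypothesis cl2 : class2 G.
Hypothesis p_pr : prime p.
Hypothesis p_odd : odd p.
Hypothesis x_gen : <<[set x i | i : 'I_d]>>%g = [set: G].
Hypothesis GpD : forall g : G, (g ^+ p)%g \in [set: G]^`(1)%g.
Hypothesis Dp1 : forall z, z \in [set: G]^`(1)%g -> (z ^+ p)%g = 1%g.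

Definition tensorZ : zmodType := abelian_zmod (tensor_squareC cl2).

Definition tens (g h : G) : tensorZ := tensor g h.

Lemma tens_crossed : crossed_pairing tens.
Proof.
case: (tensor_crossed G) => tMl tMr.
by split=> g h k; [exact: tMl | exact: tMr].
Qed.

Lemma tensZ_ind (P : tensorZ -> Prop) :
  P 0 -> (forall a b, P a -> P b -> P (a + b)) ->
  (forall a, P a -> P (- a)) -> (forall g h, P (tens g h)) -> forall a, P a.
Proof. exact: tensor_ind. Qed.

Lemma tensZ_span a : span (tenJ tens x) a.
Proof.
move: a; apply: tensZ_ind => [|a b|a|g h].
- exact: span0.
- exact: spanD.
- exact: spanN.
exact: (span_ten cl2 tens_crossed).
Qed.

Lemma tensor_card_le (J : finType) (e : J -> tensorZ) :
  (forall j, span e (lamJ tens x j)) -> (forall j, e j *+ p = 0) ->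
  ([set: tensor_square G] #<= `I_(p ^ (d * d + #|J|)))%card.
Proof.
move=> le ep; pose F := ({ffun 'I_d * 'I_d -> 'I_p} * {ffun J -> 'I_p})%type.
have <- : #|{: F}| = (p ^ (d * d + #|J|))%N.
  by rewrite card_prod !card_ffun !card_ord card_prod !card_ord expnD.
apply: (card_le_finType (f := fun uv : F =>
  \sum_ij ten tens x ij *+ uv.1 ij + \sum_j e j *+ uv.2 j : tensorZ)) => a.
have [u [v ->]] := pairing_coords cl2 tens_crossed x_gen p_pr p_odd GpD Dp1
  le ep (tensZ_span a).
by exists (u, v).
Qed.

Lemma tensor_card_bound :
  ([set: tensor_square G] #<= `I_(p ^ (d * d + #|{: lie_index d}|)))%card.
Proof.
apply: (tensor_card_le (e := lamJ tens x)) => j; first exact: span_mem.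
exact: (lamJ_p cl2 tens_crossed _ Dp1 j).
Qed.

(** Homomorphisms to an abelian group are invariant under conjugation, so the product of their
    values is a crossed pairing. *)
Lemma tensor_bilinear (f g : G -> 'F_p) :
  (forall a b, f (a * b)%g = f a + f b) -> (forall a b, g (a * b)%g = g a + g b) ->
  exists h : {additive tensorZ -> 'F_p}, forall a b, h (tens a b) = f a * g b.
Proof.
move=> fM gM; pose E : groupType := Algebra.to_multiplicative 'F_p.
have conj (k : G -> 'F_p) : (forall a b, k (a * b)%g = k a + k b) ->
    forall a b, k (lconj a b) = k b.
  by move=> kM a b; rewrite !kM (gaddV kM) addrC addKr.
have P : crossed_pairing_mul (fun a b => f a * g b : E).
  split=> a b c; rewrite !conj // ?fM ?gM.
    by rewrite mulrDl addrC.
  by rewrite mulrDr.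
pose h : tensorZ -> 'F_p := tensor_hom (fun a b => f a * g b : E).
have hD a b : h (a + b) = h a + h b by exact: (tensor_homM P).
have hB : zmod_morphism h.
  by move=> a b; apply: (addIr (h b)); rewrite -hD !subrK.
pose H : {additive tensorZ -> 'F_p} :=
  HB.pack h (GRing.isZmodMorphism.Build _ _ h hB).
exists H => a b.
exact: (tensor_homE P).
Qed.

End SpecialTensor.

Lemma Fp_mulrn p (a b : 'F_p) : (a *+ b = a * b)%R.
Proof. by rewrite -mulr_natr; congr (_ * _)%R; exact: natr_Zp. Qed.

(** * Exponent [p]: bases of the tensor square, of nabla and of the multiplier *)

Section ExponentP.

Local Open Scope ring_scope.

Variables (G : finGroupType) (p d : nat) (x : 'I_d -> G).
Hypothesis cl2 : class2 G.
Hypothesis p_pr : prime p.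
Hypothesis p_odd : odd p.
Hypothesis x_gen : <<[set x i | i : 'I_d]>>%g = [set: G].
Hypothesis expp : forall g : G, (g ^+ p = 1)%g.
Variable f : G -> magnus p d.
Hypothesis fM : forall g h, f (g * h)%g = (f g * f h)%g.
Hypothesis f_x : forall i, f (x i) = magnus_gen p i.

Let tP := tens_crossed cl2.
Local Notation tensorZ := (tensorZ cl2).
Local Notation tens := (tens cl2).

(** [mcoord1] and [mcoord2] are the coefficients of [X_i] and of [X_i X_j] in the Magnus unit of
    [g]. *)
Definition mcoord1 (i : 'I_d) (g : G) : 'F_p := ((f g).2 : 'rV['F_p]_d) 0 i.
Definition mcoord2 (i j : 'I_d) (g : G) : 'F_p := ((f g).1 : 'M['F_p]_d) i j.
Local Notation v := mcoord1.
Local Notation q := mcoord2.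

Lemma mcoord1M i g h : v i (g * h)%g = v i g + v i h.
Proof.
rewrite /v fM -[((f g * f h)%g).2]/(((f g).2 : 'rV['F_p]_d) + (f h).2).
by rewrite mxE.
Qed.

Lemma mcoord2M i j g h : q i j (g * h)%g = q i j g + q i j h + v i g * v j h.
Proof.
rewrite /q fM -[((f g * f h)%g).1]/(((f g).1 : 'M['F_p]_d) + (f h).1
  + ((f g).2 : 'rV['F_p]_d)^T *m ((f h).2 : 'rV['F_p]_d)).
by rewrite !mxE big_ord1 mxE.
Qed.

Lemma mcoord1_x i k : v i (x k) = (k == i)%:R.
Proof. by rewrite /v f_x mxE eqxx eq_sym. Qed.

Lemma mcoord2_x i j k : q i j (x k) = 0.
Proof. by rewrite /q f_x mxE. Qed.

Lemma mcoord1R i g h : v i [~ g, h]%g = 0.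
Proof. exact: gaddR (mcoord1M i) g h. Qed.

Lemma mcoord2R i j g h : q i j [~ g, h]%g = v i g * v j h - v i h * v j g.
Proof.
have := congr1 (q i j) (commgC g h).
rewrite (mcoord2M _ _ (h * g)%g) mcoord1R mulr0 addr0.
rewrite (mcoord2M i j g) (mcoord2M i j h) => e.
by apply: (addrI (q i j h + q i j g + v i h * v j g)); rewrite -e; ring.
Qed.

Lemma mcoord2RM i j y z : (forall k, v k y = 0) ->
  q i j (y * z)%g = q i j y + q i j z.
Proof. by move=> vy; rewrite mcoord2M vy mul0r addr0. Qed.

(* The coefficient of X_a X_b X_c in the product of two truncated Magnus units. *)
Definition lie_cocycle (a b c : 'I_d) (g h : G) : 'F_p :=
  v a g * q b c h + q a b g * v c h.

(** This is associativity of the product of Magnus units, read in degree 3. *)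
Lemma lie_cocycleP a b c g h k :
  lie_cocycle a b c g h + lie_cocycle a b c (g * h)%g k =
  lie_cocycle a b c h k + lie_cocycle a b c g (h * k)%g.
Proof. by rewrite /lie_cocycle !mcoord1M !mcoord2M; ring. Qed.

(** The standard 2-cycle of a commuting pair; [bh_lamJ] shows that its class is the image of
    [lamJ]. *)
Definition lie_chain (j : lie_index d) : {ffun G * G -> int} :=
  let: (a, b, c) := val j in
  basis ([~ x a, x b]%g, x c) - basis (x c, [~ x a, x b]%g).

Lemma lie_chain_cycle j : cycle2 (lie_chain j).
Proof.
rewrite /cycle2 /lie_chain; case: (val j) => [[a b] c].
rewrite raddfB /= !bar_d2_basis (cl2 (x a) (x b) (x c)).
by rewrite [X in _ - X](AC 3 (3*2*1)) subrr.
Qed.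

(* The exceptional factor 2 comes from [[X, Y], X] = 2 XYX - YXX - XXY. *)
Lemma lie_coef (a b c i j k : 'I_d) :
  (a < b)%N -> (a <= c)%N -> (i < j)%N -> (i <= k)%N ->
  lie_cocycle i j k [~ x a, x b]%g (x c) - lie_cocycle i j k (x c) [~ x a, x b]%g
    = ((a, b, c) == (i, j, k))%:R * (1 + (k == i)%:R).
Proof.
move=> ab ac ij ik; rewrite /lie_cocycle !mcoord1R !mcoord2R !mcoord2_x.
rewrite !mcoord1_x mul0r add0r addr0 !xpair_eqE.
have [ai|ai] := eqVneq a i.
  rewrite {a}ai in ab ac *.
  have -> : (b == i) = false by apply/eqP => bi; rewrite bi ltnn in ab.
  have -> : (i == j) = false by apply/eqP => bi; rewrite bi ltnn in ij.
  have [->|ck] := eqVneq c k.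
    rewrite [i == k]eq_sym; case: (b == j); case: (k == i); rewrite /=; ring.
  have [ci|] := eqVneq c i; last by case: (b == j) => _; rewrite /=; ring.
  have -> : (i == k) = false by rewrite -ci (negPf ck).
  by case: (b == j); rewrite /=; ring.
have -> : ((b == i)%:R * (a == j)%:R : 'F_p) = 0.
  case: eqP => [bi|]; last by rewrite mul0r.
  by case: eqP => [aj|]; rewrite ?mulr0 //; move: ab ij; rewrite bi aj; lia.
have [ci|_] := eqVneq c i; last by rewrite /=; ring.
(* Then [a] is smaller than [i], [j] and [k], so [X_a] does not occur in [X_i X_j X_k]. *)
have lt_ai : (a < i)%N by rewrite ltn_neqAle ai -ci.
have -> : (a == j) = false by apply/eqP => aj; move: ij lt_ai; rewrite aj; lia.
have -> : (a == k) = false by apply/eqP => ak; move: ik lt_ai; rewrite ak; lia.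
by rewrite /=; ring.
Qed.

(** By [lie_coef], the cocycle with the indices of [j0] vanishes on all the other chains and takes
    the value 1 or 2 on that of [j0], which is invertible for odd [p]. *)
Lemma lie_chain_indep (u : lie_index d -> 'F_p) :
  bar_pi (\sum_j lie_chain j *+ u j) = 0 -> u =1 fun=> 0.
Proof.
move=> u0 j0; case E0 : (val j0) => [[i j] k].
have := valP j0; rewrite E0 /= => /andP[ij ik].
pose F : {additive {ffun G * G -> int} -> 'F_p} :=
  basis_lin (fun gh : G * G => lie_cocycle i j k gh.1 gh.2).
have := basis_lin_cocycle (lie_cocycleP i j k) u0.
rewrite -[basis_lin _ _]/(F (\sum_j lie_chain j *+ u j)) raddf_sum.
have FE (l : lie_index d) : F (lie_chain l *+ u l) =
    (l == j0)%:R * (1 + (k == i)%:R) * u l.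
  rewrite raddfMn Fp_mulrn; congr (_ * _).
  rewrite /lie_chain; have := valP l; case El : (val l) => [[a b] c] /= /andP[ab ac].
  rewrite raddfB /F /= !basis_linE lie_coef //; congr (_%:R * _).
  by rewrite -El -E0.
rewrite (bigD1 j0) //= big1 ?addr0 => [|l /negPf lj]; last by rewrite FE lj !mul0r.
rewrite FE eqxx mul1r => /eqP; rewrite mulf_eq0 => /orP[|/eqP->//].
case: (k == i); last by rewrite addr0 oner_eq0.
rewrite -[1 + 1]/(2%:R) -(dvdn_pcharf (pchar_Fp p_pr)) => p2.
have p_eq2 : p = 2%N by apply/eqP; rewrite eqn_leq prime_gt1 // dvdn_leq.
by have : odd 2 by rewrite -p_eq2.
Qed.

Local Notation bh := (@bar_tensor_hom G : tensorZ -> bar_ext G).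
Local Notation binj := (cext_inj (bar_fsP G)).

Lemma bhD (a b : tensorZ) : bh (a + b) = (bh a * bh b)%g.
Proof. exact: bar_tensor_homM. Qed.

Lemma bh0 : bh 0 = binj 0.
Proof. by apply: (mulIg (bh 0)); rewrite -bhD addr0 mul1g. Qed.

Lemma bhMn (a : tensorZ) b n : bh a = binj b -> bh (a *+ n) = binj (b *+ n).
Proof.
move=> ab; elim: n => [|n IHn]; last by rewrite !mulrS bhD ab IHn cext_injD.
by apply: (mulIg (bh 0)); rewrite -bhD addr0 mul1g.
Qed.

Lemma bh_lamJ j : bh (lamJ tens x j) = binj (bar_pi (lie_chain j)).
Proof.
rewrite /lie_chain /lamJ; case: (val j) => [[a b] c] /=.
rewrite [LHS]bar_tensor_homE lift_comm_central; last exact: cl2.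
by rewrite /bar_fs opprB addrA subrK raddfB.
Qed.

Lemma bh_lam_sum (u : lie_index d -> nat) :
  bh (\sum_j lamJ tens x j *+ u j) = binj (bar_pi (\sum_j lie_chain j *+ u j)).
Proof.
elim/big_rec2: _ => [|j b a _ IH]; first by rewrite raddf0 bh0.
by rewrite bhD IH raddfD raddfMn cext_injD (bhMn _ (bh_lamJ j)).
Qed.

Lemma bh_antisym g h : bh (tens g h + tens h g) = 1%g.
Proof.
rewrite bhD [X in (X * _)%g]bar_tensor_homE [X in (_ * X)%g]bar_tensor_homE.
by rewrite /lift_comm mulgA mulgVK mulgV.
Qed.

Lemma bh_tens_diag g : bh (tens g g) = 1%g.
Proof. by rewrite [LHS]bar_tensor_homE /lift_comm mulgV. Qed.

Let Dp1 z : z \in [set: G]^`(1)%g -> (z ^+ p)%g = 1%g. Proof. by []. Qed.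

Lemma GpD1 g : (g ^+ p)%g \in [set: G]^`(1)%g.
Proof. by rewrite expp group1. Qed.

Lemma tens_p g h : tens g h *+ p = 0.
Proof. by rewrite (t_exp_odd cl2 tP h p_odd (GpD1 g) Dp1) expp (tz1l tP). Qed.

Lemma bilinear_coords (i j : 'I_d) : exists h : {additive tensorZ -> 'F_p},
  forall a b, h (tens a b) = v i a * v j b.
Proof. exact: (tensor_bilinear cl2 (mcoord1M i) (mcoord1M j)). Qed.

(** The functionals of [bilinear_coords] vanish on [lamJ] and are dual to [ten]. What then remains
    is a relation among the [lamJ], which [bh] sends to one among the [lie_chain] in [bar_quot]. *)
Lemma tenJ_indep (u : ('I_d * 'I_d) + lie_index d -> 'F_p) :
  \sum_i tenJ tens x i *+ u i = 0 -> u =1 fun=> 0.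
Proof.
rewrite big_sumType /= => u0.
have ul ij : u (inl ij) = 0.
  case: ij => i j; have [h hE] := bilinear_coords i j; have := congr1 h u0.
  rewrite raddf0 raddfD !raddf_sum [X in _ + X]big1 ?addr0 => [|k _]; last first.
    by rewrite raddfMn hE mcoord1R mul0r mul0rn.
  rewrite (bigD1 (i, j)) //= big1 ?addr0 => [|[k l] kl]; last first.
    rewrite raddfMn hE !mcoord1_x -natrM mulnb -[_ && _]/((k, l) == (i, j)).
    by rewrite (negPf kl) mul0rn.
  by rewrite raddfMn hE !mcoord1_x !eqxx mulr1 Fp_mulrn mul1r.
have z0 : \sum_ij ten tens x ij *+ u (inl ij) = 0.
  by apply: big1 => ij _; rewrite ul mulr0n.
rewrite z0 add0r in u0.
case=> [ij|j]; first exact: ul.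
apply: (lie_chain_indep (u := fun j => u (inr j))).
have := bh_lam_sum (fun j => u (inr j)); rewrite u0.
by rewrite bh0 => -[].
Qed.

Lemma tensor_Zp : isomorphic (tensor_square G) (Zp_power p (d * d + #|{: lie_index d}|)).
Proof.
have -> : (d * d + #|{: lie_index d}|)%N = #|{: ('I_d * 'I_d) + lie_index d}|.
  by rewrite card_sum card_prod !card_ord.
apply: (Zp_basis_isomorphic (A := tensorZ) (f := id) (e := tenJ tens x)) => //.
- exact: tensZ_span.
- by move=> i; exists (tenJ tens x i).
- by case=> [ij|j]; apply: tens_p.
exact: tenJ_indep.
Qed.

(** The functionals of [bilinear_coords] with [i <= j] are dual to [symJ]. *)
Lemma nabla_Zp : isomorphic (nabla G) (Zp_power p #|{: sym_index d}|).
Proof.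
apply: (Zp_basis_isomorphic (A := tensorZ) (f := fun y : nabla G => \val y : tensorZ)
  (e := symJ tens x)) => //.
- exact: val_inj.
- move=> [y /= /asboolP]; elim=> {y} [_ [g ->]||y z _ IHy _ IHz|y _ IHy].
  + exact: (span_sym cl2 tP x_gen g).
  + exact: (span0 (symJ tens x)).
  + exact: (spanD IHy IHz).
  exact: (spanN IHy).
- move=> [[i j] ij]; suff H : gen_pred (fun y : tensor_square G => exists g, y = tensor g g)
      (symJ tens x (exist _ (i, j) ij)) 
    by exists (exist (gen_pred (fun y : tensor_square G => exists g, y = tensor g g))
      _ H : nabla G).
  apply/asboolP; rewrite /symJ /=; have base g : in_gen
    (fun y : tensor_square G => exists g, y = tensor g g) (tens g g).
    by apply: in_gen_base; exists g.
  case: eqP => [_|_]; first exact: base.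
  (* Polarization: [t_sqr] expresses the off-diagonal members by squares. *)
  have -> : tens (x i) (x j) + tens (x j) (x i) =
      tens (x i * x j)%g (x i * x j)%g + - (tens (x i) (x i) + tens (x j) (x j)).
    by rewrite (t_sqr cl2 tP) addrAC subrr add0r.
  exact: (in_genM (base _) (in_genV (in_genM (base _) (base _)))).
- move=> [[i j] ij]; rewrite /symJ /=.
  by case: eqP => _; rewrite ?mulrnDl !tens_p ?addr0.
move=> u u0 [[i j] ij]; have [h hE] := bilinear_coords i j.
have := congr1 h u0; rewrite raddf0 raddf_sum.
have hs kl : h (symJ tens x kl) = (kl == exist _ (i, j) ij)%:R.
  case: kl => [[k l] kl]; rewrite -(inj_eq val_inj) /symJ /= xpair_eqE.
  move: kl ij => /= kl ij; have [kl_eq|/negPf kl_ne] := eqVneq k l.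
    by rewrite hE !mcoord1_x -natrM mulnb kl_eq.
  rewrite raddfD !hE !mcoord1_x -!natrM !mulnb.
  have [li|_] := eqVneq l i; last by rewrite addr0.
  have [kj|_] := eqVneq k j; last by rewrite addr0.
  by case/eqP: kl_ne; apply/val_inj/eqP; rewrite eqn_leq kl /= li kj.
rewrite (bigD1 (exist _ (i, j) ij)) //= big1 ?addr0 => [|kl /negPf ne]; last first.
  by rewrite raddfMn hs ne mul0rn.
by rewrite raddfMn hs eqxx Fp_mulrn mul1r.
Qed.

Definition lie_cycle (j : lie_index d) : Z2 G := exist _ (lie_chain j) (lie_chain_cycle j).

Lemma val_lie_sum (u : lie_index d -> nat) :
  \val (\sum_j lie_cycle j *+ u j) = \sum_j lie_chain j *+ u j.
Proof. by rewrite raddf_sum; apply: eq_bigr => j _; rewrite raddfMn. Qed.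

(** Enough elements to span modulo the kernel of [bh], which contains all [g (x) g] and all
    [g (x) h + h (x) g]. *)
Definition wedgeJ (i : {ij : 'I_d * 'I_d | (ij.1 < ij.2)%N} + lie_index d) :
    tensorZ :=
  match i with inl ij => ten tens x (val ij) | inr j => lamJ tens x j end.

Lemma bhN a : bh (- a) = (bh a)^-1%g.
Proof. by apply: (mulIg (bh a)); rewrite -bhD addNr mulVg bh0. Qed.

Lemma bh_wedge a : exists b, bh a = bh b /\ span wedgeJ b.
Proof.
move: a (tensZ_span x_gen a); apply: span_ind.
- by exists 0; split=> //; apply: span0.
- move=> a1 a2 [b1 [e1 s1]] [b2 [e2 s2]]; exists (b1 + b2).
  by rewrite !bhD e1 e2; split=> //; apply: spanD.
- by move=> a1 [b [e1 s1]]; exists (- b); rewrite !bhN e1; split=> //; apply: spanN.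
case=> [[i j]|j]; last first.
  by exists (lamJ tens x j); split=> //; exact: (span_mem wedgeJ (inr j)).
have lt (k l : 'I_d) : (k < l)%N -> span wedgeJ (tens (x k) (x l)).
  by move=> kl; exact: (span_mem wedgeJ (inl (exist _ (k, l) kl))).
rewrite /= /ten /=; case: (ltngtP i j) => [ij|ji|/val_inj ->].
- by exists (tens (x i) (x j)); split=> //; apply: lt.
- exists (- tens (x j) (x i)); split; last exact/spanN/lt.
  apply: (mulIg (bh (tens (x j) (x i)))).
  by rewrite -!bhD bh_antisym addNr bh0.
exists (0 : tensorZ); split; last exact: span0.
by rewrite [LHS]bh_tens_diag [RHS]bh0.
Qed.

Lemma mcoord2_1 i j : q i j 1%g = 0.
Proof. by have := mcoord2R i j 1%g 1%g; rewrite commgg subrr. Qed.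

(** In [G] the map [bh] is a commutator map, whose degree 2 part is the antisymmetrization
    [v (x) w - w (x) v]. *)
Lemma bh_mcoord i j (h h' : {additive tensorZ -> 'F_p}) :
  (forall a b, h (tens a b) = v i a * v j b) ->
  (forall a b, h' (tens a b) = v j a * v i b) ->
  forall a, (forall k, v k (bh a).2 = 0) /\ q i j (bh a).2 = h a - h' a.
Proof.
move=> hE hE'; apply: tensZ_ind => [|a b [va qa] [vb qb]|a [va qa]|a b].
- rewrite bh0 (raddf0 h) (raddf0 h') subrr; split=> [k|]; first exact: (gadd1 (mcoord1M k)).
  exact: mcoord2_1.
- rewrite bhD; split=> [k|]; first by rewrite mcoord1M va vb addr0.
  by rewrite mcoord2RM // qa qb (raddfD h) (raddfD h') opprD addrACA.
- have -> : (bh (- a)).2 = ((bh a).2^-1)%g by rewrite bhN.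
  split=> [k|]; first by rewrite (gaddV (mcoord1M k)) va oppr0.
  have := mcoord2_1 i j; rewrite -{1}(mulgV (bh a).2) mcoord2RM // qa => e.
  by apply: (addrI (h a - h' a)); rewrite e (raddfN h) (raddfN h'); ring.
rewrite hE hE'; have -> : (bh (tens a b)).2 = (a * b * (b * a)^-1)%g.
  by rewrite [bh _]bar_tensor_homE.
have vc k : v k (a * b * (b * a)^-1)%g = 0.
  by rewrite (mcoord1M k) (gaddV (mcoord1M k)) !mcoord1M [v k b + _]addrC subrr.
split=> //; have := mcoord2RM i j (b * a)%g vc.
rewrite mulgVK !mcoord2M => e; apply: (addIr (q i j b + q i j a + v i b * v j a)).
by rewrite -e; ring.
Qed.

Lemma lie_cycle_p j : schur_pi (lie_cycle j) *+ p = 0.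
Proof.
rewrite -raddfMn; apply/schur_pi_eq0; rewrite raddfMn raddfMn.
have := bhMn p (bh_lamJ j); rewrite (lamJ_p cl2 tP x Dp1 j) bh0.
by move=> [].
Qed.

(** By [cycle2_tensor] a cycle is the image under [bh] of a tensor, which may be taken in the span
    of [wedgeJ]. As its component in [G] is 1, only the [lamJ] part survives. *)
Lemma lie_cycle_span m : span (@schur_pi G \o lie_cycle) m.
Proof.
have [z <-] := schur_pi_surj m.
have z0 : bar_d2 (\val z) = 0 by have /eqP := valP z.
have [a za] := cycle2_tensor z0; have [b [ab sb]] := bh_wedge a.
have wp i : wedgeJ i *+ p = 0 by case: i => [ij|j]; apply: tens_p.
have [u bE] := span_modp wp (prime_gt0 p_pr) sb.
have ul kl : wedgeJ (inl kl) *+ u (inl kl) = 0.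
  case: kl => [[k l] kl]; set w := inl _.
  have [h hE] := bilinear_coords k l; have [h' hE'] := bilinear_coords l k.
  (* The degree 2 coordinate of 1 is 0, while by [bh_mcoord] it is the coefficient [u w] modulo
     [p]. *)
  have [_] := bh_mcoord hE hE' b; rewrite -ab [bh a]za mcoord2_1.
  have hb : h b - h' b = (u w : nat)%:R.
    transitivity (\sum_i (h (wedgeJ i *+ u i) - h' (wedgeJ i *+ u i))).
      by rewrite bE (raddf_sum h) (raddf_sum h') sumrB.
    rewrite (bigD1 w) //= big1 ?addr0 => [|i ne].
      rewrite (raddfMn h) (raddfMn h') hE hE' !mcoord1_x !eqxx /=.
      have -> : (k == l) = false by apply/eqP => e; have := kl; rewrite /= e ltnn.
      by rewrite mul0r mul0rn subr0 mulr1.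
    case: i ne => [[[i j] ij]|j] ne; last first.
      by rewrite (raddfMn h) (raddfMn h') hE hE' !mcoord1R !mul0r !mul0rn subr0.
    rewrite (raddfMn h) (raddfMn h') hE hE' !mcoord1_x -!natrM !mulnb /=.
    have -> : (i == k) && (j == l) = false.
      apply: contraNF ne => /andP[/eqP ik /eqP jl]; apply/eqP; congr inl.
      by apply: val_inj; rewrite /= ik jl.
    have -> : (i == l) && (j == k) = false.
      apply/andP => -[/eqP il /eqP jk]; have := ij.
      by rewrite /= il jk => /ltn_trans/(_ kl); rewrite ltnn.
    by rewrite !mul0rn subr0.
  rewrite hb => /esym/eqP; rewrite -(dvdn_pcharf (pchar_Fp p_pr)) => /dvdnP[n ->].
  by rewrite mulnC mulrnA wp mul0rn.
exists (fun j => (u (inr j))%:Z).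
have {}bE : b = \sum_j lamJ tens x j *+ u (inr j).
  have w0 : \sum_kl wedgeJ (inl kl) *+ u (inl kl) = 0 by apply: big1 => kl _; exact: ul.
  by rewrite big_sumType w0 in bE; rewrite [LHS]bE; exact: add0r.
have := bh_lam_sum (fun j => u (inr j)); rewrite -bE -ab [bh a]za => -[] e.
apply/eqP; rewrite -subr_eq0; apply/eqP.
transitivity (schur_pi (z - \sum_j lie_cycle j *+ u (inr j))).
  rewrite (raddfB (@schur_pi G)) (raddf_sum (@schur_pi G)); congr (schur_pi z - _)%R.
  by apply: eq_bigr => j _; rewrite (raddfMn (@schur_pi G)).
apply/schur_pi_eq0; have -> : \val (z - \sum_j lie_cycle j *+ u (inr j)) =
    \val z - \sum_j lie_chain j *+ u (inr j).
  by rewrite raddfB [X in _ - X](val_lie_sum (fun j => u (inr j))).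
by rewrite (raddfB (@bar_pi G)); apply/eqP; rewrite subr_eq0; apply/eqP; exact: e.
Qed.

Lemma schur_Zp : isomorphic (Algebra.to_multiplicative (schur_multiplier G))
  (Zp_power p #|{: lie_index d}|).
Proof.
apply: (Zp_basis_isomorphic (X := Algebra.to_multiplicative (schur_multiplier G))
  (A := schur_multiplier G) (f := fun m => m) (e := @schur_pi G \o lie_cycle)) => //.
- exact: lie_cycle_span.
- by move=> j; exists (schur_pi (lie_cycle j)).
- exact: lie_cycle_p.
move=> u u0; apply: lie_chain_indep; rewrite -val_lie_sum; apply/schur_pi_eq0.
by rewrite raddf_sum -[RHS]u0; apply: eq_bigr => j _; rewrite raddfMn.
Qed.

End ExponentP.

Lemma card_ge_finType (F : finType) (T : Type) (f : T -> F) :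
  (forall u, exists y, f y = u) -> (`I_#|F| #<= [set: T])%card.
Proof.
move=> f_surj; have : (`I_#|F| #<= [set: 'I_#|F|])%card.
  by have := @card_II #|F|; rewrite card_eq_le => /andP[].
move=> /card_le_trans; apply.
have -> : [set: 'I_#|F|]%classic = ((enum_rank \o f) @` [set: T])%classic.
  apply/seteqP; split=> i // _; have [y fy] := f_surj (enum_val i).
  by exists y => //=; rewrite fy enum_valK.
exact: card_image_le.
Qed.

(** In class 2 the [p]-th power map is multiplicative up to a commutator to the power ['C(p, 2)], a
    multiple of [p]. *)
Lemma class2_exp_gen (G : finGroupType) (p d : nat) (x : 'I_d -> G) :
  class2 G -> odd p -> (forall z, z \in [set: G]^`(1) -> z ^+ p = 1) ->
  <<[set x i | i : 'I_d]>> = [set: G] -> (forall i, x i ^+ p = 1) ->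
  forall g : G, g ^+ p = 1.
Proof.
move=> cl2 p_odd Dp1 x_gen xp.
apply: (gen_x x_gen) => [|i g IH]; first exact: expg1n.
rewrite expMg_Rmul; try exact/commute_sym/cl2.
rewrite xp IH !mul1g bin2odd // expgnA Dp1 ?expg1n //.
by rewrite derg1 mem_commg ?inE.
Qed.

(** * The converse: the exponent read off from the tensor square *)

Section SpecialOfMaximalRank.

Variables (G : finGroupType) (p d : nat) (x : 'I_d -> G).
Hypothesis cl2 : class2 G.
Hypothesis p_pr : prime p.
Hypothesis p_odd : odd p.
Hypothesis x_gen : <<[set x i | i : 'I_d]>> = [set: G].
Hypothesis GpD : forall g : G, g ^+ p \in [set: G]^`(1).
Hypothesis Dp1 : forall z, z \in [set: G]^`(1) -> z ^+ p = 1.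

Lemma tensor_Zp_exp : 0 < d ->
  isomorphic (tensor_square G) (Zp_power p (d * d + #|{: lie_index d}|)) ->
  forall g : G, g ^+ p = 1.
Proof.
move=> d_gt0 [f [f' fK f'K]]; apply: (class2_exp_gen cl2 p_odd Dp1 x_gen) => i.
apply/eqP/negPn/negP => xi_p.
(* [lam_relation] concerns the generator of index 0, so [x i] is moved there. *)
pose y := x \o tperm i (Ordinal d_gt0).
have y_gen : <<[set y k | k : 'I_d]>> = [set: G].
  rewrite -x_gen; congr <<_>>; apply/finset.setP => g; apply/imsetP/imsetP => -[k _ ->].
    by exists (tperm i (Ordinal d_gt0) k).
  by exists (tperm i (Ordinal d_gt0) k); last rewrite /y /= tpermK.
have yp : y (Ordinal d_gt0) ^+ p <> 1 by rewrite /y /= tpermR; apply/eqP.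
have tP := tens_crossed cl2.
have [j0 sp] := lam_relation cl2 tP y_gen p_pr p_odd GpD Dp1
  (erefl : val (Ordinal d_gt0) = 0) yp.
(* Without [j0] the spanning family is shorter by one, so the order would be at most [p ^ (r - 1)],
   where [r] is the assumed rank. *)
have le_card := tensor_card_le p_pr p_odd y_gen GpD Dp1 sp
  (fun j => lamJ_p cl2 tP y Dp1 (val j)).
have ge_card : (`I_(p ^ (d * d + #|{: lie_index d}|)) #<= [set: tensor_square G])%card.
  have <- : #|{: 'rV['F_p]_(d * d + #|{: lie_index d}|)}| =
      (p ^ (d * d + #|{: lie_index d}|))%N by rewrite card_mx mul1n card_Fp.
  by apply: (card_ge_finType (f := f)) => u; exists (f' u).
have := card_le_trans ge_card le_card; rewrite card_le_II leq_exp2l ?prime_gt1 //.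
rewrite leq_add2l leqNgt => /negP; apply.
have -> : #|{: {j | j != j0}}| = #|{: lie_index d}|.-1 by rewrite card_sig; exact: cardC1.
by rewrite ltn_predL; apply/card_gt0P; exists j0.
Qed.

End SpecialOfMaximalRank.

Theorem corollary3p4 (gT : finGroupType) (H : {group gT}) (p d : nat)
    (p_prime : prime p) (p_neq2 : p <> 2) (d_ge3 : 3 <= d)
    (H_gen : 'm(H) = d) (H_special : special_pgroup p H)
    (H_rank : #|H^`(1)| = (p ^ (d * (d - 1) %/ 2))%N) :
  let r := (d * (d ^ 2 + 3 * d - 1) %/ 3)%N in
  let tensorH : groupType := tensor_square (subg_of H) in
  let sumH : groupType :=
    (Algebra.to_multiplicative (schur_multiplier (subg_of H))
       * subg_of (H^`(1))%G * nabla (subg_of H))%type in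
  ([set: tensorH] #<= `I_(p ^ r))%card /\
  (exponent H = p <->
     isomorphic tensorH sumH /\ isomorphic sumH (Zp_power p r)).
Proof.
have p_odd : odd p by case: (even_prime p_prime).
have d_gt0 : 0 < d by apply: leq_trans d_ge3.
have isoG := isog_subg H; set G := subg_of H in isoG *.
have [pH nabH spH abH] := H_special.
have G_special : special_pgroup p [set: G]%G.
  split; first by rewrite -(isog_pgroup _ isoG).
  - by rewrite -(isog_abelian isoG).
  - exact: (isog_special isoG).
  by rewrite -(isog_abelem (isog_der 1 isoG)).
have mG : 'm([set: G]) = d by rewrite -(isog_grank isoG).
have [cl2 GpD Dp1 [x x_gen] oG] := special_pgroup_facts p_prime G_special mG.
have binE : (d * (d - 1) %/ 2)%N = 'C(d, 2) by rewrite bin2 subn1 divn2.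
rewrite binE in H_rank.
move=> r tensorH sumH; have rE : r = (d * d + #|{: lie_index d}|)%N by exact: tensor_rank_sum.
have expE : exponent H = p <-> forall g : G, g ^+ p = 1.
  rewrite (exponent_isog isoG); split=> [<- g|expp]; first by rewrite expg_exponent ?inE.
  have : exponent [set: G] %| p by apply/exponentP => g _.
  have [_ p_div] := primeP p_prime; move=> /p_div/orP[/eqP e1|/eqP//].
  (* Exponent 1 is excluded because [H] is not abelian. *)
  have H1 : H :==: 1 by rewrite trivg_exponent (exponent_isog isoG) e1.
  by case/negP: nabH; rewrite (eqP H1) abelian1.
split; first by rewrite rE; apply: (tensor_card_bound cl2 p_prime p_odd x_gen GpD Dp1).
rewrite expE rE; split=> [expp|[TS SZ]]; last first.
  by apply: (tensor_Zp_exp cl2 p_prime p_odd x_gen GpD Dp1 d_gt0); exact: isomorphic_trans SZ.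
have oG' : p ^ (d + 'C(d, 2)) <= #|[set: G]|.
  by rewrite (leq_trans _ oG) // expnD -(card_isog (isog_der 1 isoG)) H_rank.
have [f [fM fx]] := magnus_embedding p_prime p_odd cl2 expp x_gen oG'.
have TZ := tensor_Zp cl2 p_prime p_odd x_gen expp fM fx.
have SZ : isomorphic sumH (Zp_power p (d * d + #|{: lie_index d}|)).
  (* The three summands are the ranks of the Schur multiplier, of [H'] and of nabla. *)
  have -> : (d * d + #|{: lie_index d}| =
      #|{: lie_index d}| + 'C(d, 2) + #|{: sym_index d}|)%N.
    by rewrite -bin2_sqr card_sym_index addnC addnA.
  apply: isomorphic_prod_Zp; last exact: nabla_Zp fM fx.
  apply: isomorphic_prod_Zp; first exact: schur_Zp fM fx.
  by apply: abelem_isomorphic; rewrite ?bin_gt0 // ltnW.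
by split=> //; apply: isomorphic_trans TZ (isomorphic_sym SZ).
Qed.
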